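(* The Fault-Tolerant Flow problem admits a polynomial-time $(\ell+1)$-factor approximation algorithm.
   Context: Fault-Tolerant Flow (FTF): given a directed graph $D=(V,A)$ with non-negative arc weights, two vertices $s,t\in V$, a set $M\subseteq A$ of vulnerable arcs and an integer $\ell\geq 1$, find a minimum-weight set $S\subseteq A$ such that for every $f\in M$, the set $S\setminus\{f\}$ contains $\ell$ arc-disjoint $s$-$t$ paths. *)

(* Defs.v *)
From HB Require Import structures.
From mathcomp Require Import all_boot all_order all_algebra.

Set Implicit Arguments.
Unset Strict Implicit.
Unset Printing Implicit Defensive.

Import Order.TTheory GRing.Theory Num.Theory.

(* Model of computation: the WHILE language of N. D. Jones ("Computability and
   Complexity from a Programming Perspective") over binary trees.  Unlike in
   its unit-cost semantics, evaluating an expression costs the total size of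
   the values of all its subexpressions, so that a run of cost k is simulated
   by a multitape Turing machine in time polynomial in k and the input size,
   and conversely: polynomial time here is the usual polynomial time, for
   functions as well as for decision problems. *)

Inductive tree := Leaf | Node of tree & tree.

Fixpoint tree_size (d : tree) : nat :=
  if d is Node l r then (tree_size l + tree_size r).+1 else 1%N.

Fixpoint tree_eqb (d e : tree) : bool :=
  match d, e with
  | Leaf, Leaf => true
  | Node d1 d2, Node e1 e2 => tree_eqb d1 e1 && tree_eqb d2 e2
  | _, _ => false
  end.

Definition tree_of_bool (b : bool) : tree := if b then Node Leaf Leaf else Leaf.

Definition is_node (d : tree) : bool := if d is Node _ _ then true else false.

Inductive expr :=
  | EVar of nat
  | ENil
  | ECons of expr & expr
  | EHd of expr
  | ETl of expr
  | EEq of expr & expr.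

Inductive cmd :=
  | CSkip
  | CAssign of nat & expr
  | CSeq of cmd & cmd
  | CIf of expr & cmd & cmd
  | CWhile of expr & cmd.

Definition store := nat -> tree.

Definition upd (st : store) (x : nat) (d : tree) : store :=
  fun y => if y == x then d else st y.

Fixpoint eval (st : store) (e : expr) : tree :=
  match e with
  | EVar x => st x
  | ENil => Leaf
  | ECons e1 e2 => Node (eval st e1) (eval st e2)
  | EHd e1 => if eval st e1 is Node l _ then l else Leaf
  | ETl e1 => if eval st e1 is Node _ r then r else Leaf
  | EEq e1 e2 => tree_of_bool (tree_eqb (eval st e1) (eval st e2))
  end.

Fixpoint ecost (st : store) (e : expr) : nat :=
  (tree_size (eval st e) +
   match e with
   | EVar _ | ENil => 0
   | EHd e1 | ETl e1 => ecost st e1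
   | ECons e1 e2 | EEq e1 e2 => ecost st e1 + ecost st e2
   end)%N.

(* [exec c st k st'] : started in [st], [c] halts in [st'], at cost [k]. *)
Inductive exec : cmd -> store -> nat -> store -> Prop :=
  | exec_skip st : exec CSkip st 1 st
  | exec_assign st x e :
      exec (CAssign x e) st (ecost st e).+1 (upd st x (eval st e))
  | exec_seq c1 c2 st1 st2 st3 k1 k2 :
      exec c1 st1 k1 st2 -> exec c2 st2 k2 st3 ->
      exec (CSeq c1 c2) st1 (k1 + k2) st3
  | exec_if_true e c1 c2 st st' k :
      is_node (eval st e) -> exec c1 st k st' ->
      exec (CIf e c1 c2) st (ecost st e + k).+1 st'
  | exec_if_false e c1 c2 st st' k :
      ~~ is_node (eval st e) -> exec c2 st k st' ->
      exec (CIf e c1 c2) st (ecost st e + k).+1 st'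
  | exec_while_false e c st :
      ~~ is_node (eval st e) -> exec (CWhile e c) st (ecost st e).+1 st
  | exec_while_true e c st1 st2 st3 k1 k2 :
      is_node (eval st1 e) -> exec c st1 k1 st2 ->
      exec (CWhile e c) st2 k2 st3 ->
      exec (CWhile e c) st1 (ecost st1 e + k1 + k2).+1 st3.

(* Variable 0 holds the input at the start and the output at the end. *)
Definition runs (c : cmd) (d : tree) (k : nat) (d' : tree) : Prop :=
  exists2 st, exec c (upd (fun=> Leaf) 0 d) k st & st 0%N = d'.

Local Open Scope ring_scope.

Definition polytime (I : Type) (O : I -> Type) (encI : I -> tree)
    (encO : forall i, O i -> tree) (f : forall i, O i) : Prop :=
  exists (c : cmd) (p : {poly nat}), forall i : I,
    exists2 k, runs c (encI i) k (encO i (f i)) & (k <= p.[tree_size (encI i)])%N.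

Definition enc_seq (s : seq tree) : tree := foldr Node Leaf s.

(* Binary notation, least significant bit first. *)
Fixpoint enc_pos (p : BinNums.positive) : tree :=
  match p with
  | BinNums.xH => Node (tree_of_bool true) Leaf
  | BinNums.xO q => Node (tree_of_bool false) (enc_pos q)
  | BinNums.xI q => Node (tree_of_bool true) (enc_pos q)
  end.

Definition enc_nat (n : nat) : tree :=
  if bin_of_nat n is BinNums.Npos p then enc_pos p else Leaf.

(* Only used on nonnegative rationals, hence no sign. *)
Definition enc_rat (q : rat) : tree :=
  Node (enc_nat `|numq q|%N) (enc_nat `|denq q|%N).

(* Parallel arcs and loops are allowed. *)
Record ftf_instance := FTFInstance {
  nvert : nat;
  narc : nat;
  arc_tail : 'I_narc -> 'I_nvert;
  arc_head : 'I_narc -> 'I_nvert;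
  weight : 'I_narc -> rat;
  source : 'I_nvert;
  target : 'I_nvert;
  vulnerable : {set 'I_narc};
  ell : nat;
  weight_ge0 : forall a, 0 <= weight a;
  ell_ge1 : (1 <= ell)%N
}.

Notation vertex I := 'I_(nvert I).
Notation darc I := 'I_(narc I).

Section FaultTolerantFlow.
Variable I : ftf_instance.
Implicit Types (x y : vertex I) (a f : darc I) (S : {set darc I}).

Fixpoint diwalk x (p : seq (darc I)) y : bool :=
  if p is a :: p' then (arc_tail a == x) && diwalk (arc_head a) p' y else x == y.

Definition dipath x (p : seq (darc I)) y : bool :=
  diwalk x p y && uniq (x :: [seq arc_head a | a <- p]).

Definition has_disjoint_paths (k : nat) x y S : Prop :=
  exists P : 'I_k -> seq (darc I),
    (forall i, dipath x (P i) y /\ {subset P i <= S}) /\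
    (forall i j, i != j -> forall a, ~~ ((a \in P i) && (a \in P j))).

Definition feasible S : Prop :=
  forall f, f \in vulnerable I ->
    has_disjoint_paths (ell I) (source I) (target I) (S :\ f).

Definition total_weight S : rat := \sum_(a in S) weight a.

Definition enc_arc a : tree :=
  enc_seq [:: enc_nat (arc_tail a); enc_nat (arc_head a); enc_rat (weight a);
              tree_of_bool (a \in vulnerable I)].

Definition enc_instance : tree :=
  enc_seq [:: enc_seq [seq enc_nat x | x : vertex I <- enum 'I_(nvert I)];
              enc_seq [seq enc_arc a | a : darc I <- enum 'I_(narc I)];
              enc_nat (source I); enc_nat (target I); enc_nat (ell I)].

(* A set of arcs is output as its characteristic vector. *)
Definition enc_solution (o : option {set darc I}) : tree :=
  if o is Some B
  then Node Leaf (enc_seq [seq tree_of_bool (a \in B) | a <- enum 'I_(narc I)])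
  else Leaf.

End FaultTolerantFlow.

(* The answer [None] reports that the instance has no feasible solution. *)
Definition approximates (rho : ftf_instance -> rat)
    (alg : forall I : ftf_instance, option {set darc I}) : Prop :=
  forall I : ftf_instance,
    match alg I with
    | Some B => feasible B /\
        forall S' : {set darc I}, feasible S' ->
          total_weight B <= rho I * total_weight S'
    | None => forall S : {set darc I}, ~ feasible S
    end.

(* Main.v *)
Require Import Defs.
From HB Require Import structures.
From mathcomp Require Import all_boot all_order all_algebra.
From mathcomp Require Import zify ring.

Set Implicit Arguments.
Unset Strict Implicit.
Unset Printing Implicit Defensive.

Import Order.TTheory GRing.Theory Num.Theory.

(** Give vulnerable arcs capacity [l] and the other arcs capacity [l + 1].  An
    s-t cut has capacity at least [l (l + 1)] iff, whichever vulnerable arc is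
    deleted, it keeps [l] arcs.  By Menger's theorem, if some arc is vulnerable,
    this holds for all s-t cuts of [S] iff [S] is feasible.  Hence the support
    of a minimum-cost integral flow of value [l (l + 1)] is feasible, and it
    weighs at most the cost of that flow; an optimal solution carries such a
    flow, whose cost is at most [l + 1] times its weight.

    The flow is found by a primal-dual method on unit copies of the arcs: grow
    a tree of residual arcs of reduced cost zero from the source; when it gets
    stuck, lower the reduced costs across its boundary by their minimum; when it
    reaches the target, reverse the tree path.  Only reduced costs are stored,
    so all numbers are natural, and they gain at most one bit per step. *)

Lemma tree_eqbP : Equality.axiom tree_eqb.
Proof.
elim=> [|l IHl r IHr] [|l' r'] /=; try by constructor.
apply: (iffP andP) => [[/IHl-> /IHr->]|[<- <-]] //.
by split; [apply/IHl | apply/IHr].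
Qed.
HB.instance Definition _ := hasDecEq.Build tree tree_eqbP.

Class Enc (A : Type) := enc : A -> tree.
#[export] Instance enc_tree : Enc tree := id.
#[export] Instance enc_unit : Enc unit := fun=> Leaf.
#[export] Instance enc_bool : Enc bool := tree_of_bool.
#[export] Instance enc_prod A B (eA : Enc A) (eB : Enc B) : Enc (A * B) :=
  fun p => Node (enc p.1) (enc p.2).
#[export] Instance enc_list A (eA : Enc A) : Enc (seq A) :=
  fun s => enc_seq (map enc s).
#[export] Instance enc_option A (eA : Enc A) : Enc (option A) :=
  fun o => if o is Some a then Node Leaf (enc a) else Leaf.

Definition esize {A} {eA : Enc A} (a : A) : nat := tree_size (enc a).

Lemma tree_size_gt0 d : 0 < tree_size d. Proof. by case: d. Qed.

Section EncodingSize.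
Context {A B : Type} {eA : Enc A} {eB : Enc B}.
Implicit Types (a : A) (s : seq A).

Lemma esize_gt0 a : 0 < esize a. Proof. exact: tree_size_gt0. Qed.

Lemma esize_pair a (b : B) : esize (a, b) = (esize a + esize b).+1.
Proof. by []. Qed.

Lemma esize_nil : esize (@nil A) = 1. Proof. by []. Qed.

Lemma esize_cons a s : esize (a :: s) = (esize a + esize s).+1.
Proof. by []. Qed.

Lemma esize_None : esize (@None A) = 1. Proof. by []. Qed.

Lemma esize_Some a : esize (Some a) = (esize a).+2. Proof. by []. Qed.

Lemma size_le_esize s : size s <= esize s.
Proof. by elim: s => //= a s IH; rewrite esize_cons; lia. Qed.

Lemma esize_catrev s s' : (esize (catrev s s')).+1 = esize s + esize s'.
Proof.
elim: s s' => [|a s IH] s' /=; first by rewrite esize_nil; lia.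
by rewrite IH !esize_cons; lia.
Qed.

Lemma esize_rev s : esize (rev s) = esize s.
Proof. by have := esize_catrev s [::]; rewrite esize_nil /rev; lia. Qed.

Lemma esize_seq_le b s :
  all (fun a => esize a <= b) s -> esize s <= (size s * b.+1).+1.
Proof. by elim: s => //= a s IH /andP[? /IH]; rewrite esize_cons; lia. Qed.

Lemma all_esize_le s b : esize s <= b -> all (fun a => esize a <= b) s.
Proof.
elim: s => //= a s IH; rewrite esize_cons => le_b.
by rewrite IH ?andbT; lia.
Qed.

Lemma all_esize_take i s : all (fun a => esize a <= esize s) (take i s).
Proof.
by have := all_esize_le (leqnn (esize s)); rewrite -{2}(cat_take_drop i s) all_cat => /andP[].
Qed.

Lemma size_take_le_esize i s : size (take i s) <= esize s.
Proof. by rewrite size_take_min; apply: leq_trans (geq_minr _ _) (size_le_esize s). Qed.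

End EncodingSize.

Lemma esize_bool (b : bool) : esize b <= 3. Proof. by case: b. Qed.

Definition unary (n : nat) : tree := iter n (Node Leaf) Leaf.

Lemma esize_unary n : esize (unary n) = n.*2.+1.
Proof.
elim: n => //= n IH.
by rewrite (_ : esize (Node Leaf (unary n)) = (1 + esize (unary n)).+1) // IH; lia.
Qed.

Lemma unary_inj : injective unary.
Proof.
move=> m n eq_mn; have : esize (unary m) = esize (unary n) by rewrite eq_mn.
by rewrite !esize_unary; lia.
Qed.

Definition esizeE := (@esize_pair, @esize_nil, @esize_cons, @esize_None, @esize_Some).

(** * Polynomially bounded functions *)

Definition pbounded {A} {eA : Enc A} (g : A -> nat) : Prop :=
  exists e, forall a, g a <= (esize a + 2) ^ e.

Section PolynomialBounds.
Context {A : Type} {eA : Enc A}.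
Implicit Types g h : A -> nat.

Lemma pbounded_le g h : (forall a, g a <= h a) -> pbounded h -> pbounded g.
Proof. by move=> le_gh [e he]; exists e => a; apply: leq_trans (le_gh a) (he a). Qed.

Lemma pbounded_cst n : pbounded (fun _ : A => n).
Proof.
exists n => a; apply: leq_trans (ltnW (ltn_expl n (isT : 1 < 2))) _.
by case: n => // n; rewrite leq_exp2r //; lia.
Qed.

Lemma pboundedM g h : pbounded g -> pbounded h -> pbounded (fun a => g a * h a).
Proof. by move=> [e ge] [e' he]; exists (e + e') => a; rewrite expnD leq_mul. Qed.

Lemma pboundedD g h : pbounded g -> pbounded h -> pbounded (fun a => g a + h a).
Proof.
move=> [d gd] [d' hd]; exists (maxn d d').+1 => a.
have exp_le i j : i <= j -> (esize a + 2) ^ i <= (esize a + 2) ^ j.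
  by move=> le_ij; rewrite leq_exp2l //; lia.
have := gd a; have := hd a.
have := exp_le _ _ (leq_maxl d d'); have := exp_le _ _ (leq_maxr d d').
by rewrite expnS; nia.
Qed.

Lemma pboundedS g : pbounded g -> pbounded (fun a => (g a).+1).
Proof. by move=> bg; apply: pbounded_le (pboundedD bg (pbounded_cst 1)) => a; lia. Qed.

Lemma pboundedX g n : pbounded g -> pbounded (fun a => g a ^ n).
Proof.
move=> bg; elim: n => [|n IH]; first exact: (pbounded_cst 1).
by apply: pbounded_le (pboundedM bg IH) => a; rewrite expnS.
Qed.

Lemma pbounded_esize : pbounded (fun a : A => esize a).
Proof. by exists 1 => a; rewrite expn1; lia. Qed.

Lemma pbounded_uniform B (eB : Enc B) (g : B -> nat) (m : A -> nat) :
  pbounded g -> pbounded m ->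
  exists2 h, pbounded h & forall a b, esize b <= m a -> g b <= h a.
Proof.
move=> [e ge] bm; exists (fun a => (m a + 2) ^ e).
  exact/pboundedX/pboundedD/pbounded_cst.
move=> a b le_m; apply: leq_trans (ge b) _.
by case: (e) => // e'; rewrite leq_exp2r // leq_add2r.
Qed.

Lemma pbounded_comp B (eB : Enc B) (g : B -> nat) (f : A -> B) :
  pbounded g -> pbounded (fun a => esize (f a)) -> pbounded (fun a => g (f a)).
Proof.
move=> bg bf; have [h bh le_h] := pbounded_uniform bg bf.
by apply: pbounded_le bh => a; apply: le_h.
Qed.

End PolynomialBounds.

(** * Total correctness with a cost bound *)

Definition halts_within (c : cmd) (st : store) (b : nat) (Q : store -> Prop) : Prop :=
  exists k st', [/\ exec c st k st', k <= b & Q st'].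

Section CostLogic.
Implicit Types (c : cmd) (st : store) (e : expr) (Q : store -> Prop).

Lemma halts_within_weaken c st b b' Q Q' :
  halts_within c st b Q -> b <= b' -> (forall st', Q st' -> Q' st') ->
  halts_within c st b' Q'.
Proof.
move=> [k [st' [ex le_b Qst']]] le_b' QQ'; exists k, st'.
by split=> //; [apply: leq_trans le_b' | apply: QQ'].
Qed.

Lemma halts_within_assign x e st b Q :
  ecost st e < b -> Q (upd st x (eval st e)) -> halts_within (CAssign x e) st b Q.
Proof.
move=> lt_b Qupd; exists (ecost st e).+1, (upd st x (eval st e)).
by split=> //; exact: exec_assign.
Qed.

Lemma halts_within_seq b1 b2 c1 c2 st b Q :
  b1 + b2 <= b -> halts_within c1 st b1 (fun st' => halts_within c2 st' b2 Q) ->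
  halts_within (CSeq c1 c2) st b Q.
Proof.
move=> le_b [k1 [st1 [ex1 le1 [k2 [st2 [ex2 le2 Qst2]]]]]]; exists (k1 + k2), st2.
by split=> //; [apply: exec_seq ex1 ex2 | lia].
Qed.

Lemma halts_within_bind b1 b2 c1 c2 st b P Q :
  halts_within c1 st b1 P -> b1 + b2 <= b ->
  (forall st', P st' -> halts_within c2 st' b2 Q) -> halts_within (CSeq c1 c2) st b Q.
Proof.
move=> run1 le_b run2; apply: (halts_within_seq le_b).
exact: halts_within_weaken run1 (leqnn _) run2.
Qed.

Lemma halts_within_if b0 e c1 c2 st b Q :
  ecost st e + b0 < b ->
  halts_within (if is_node (eval st e) then c1 else c2) st b0 Q ->
  halts_within (CIf e c1 c2) st b Q.
Proof.
move=> lt_b [k [st' [ex le_b0 Qst']]]; exists (ecost st e + k).+1, st'.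
split=> //; last by lia.
by case: ifPn ex => [/exec_if_true | /exec_if_false]; apply.
Qed.

Lemma halts_within_while_false e c st b Q :
  ~~ is_node (eval st e) -> ecost st e < b -> Q st -> halts_within (CWhile e c) st b Q.
Proof.
move=> stop lt_b Qst; exists (ecost st e).+1, st.
by split=> //; exact: exec_while_false.
Qed.

Lemma halts_within_while_true b1 b2 e c st b Q :
  is_node (eval st e) -> ecost st e + b1 + b2 < b ->
  halts_within c st b1 (fun st' => halts_within (CWhile e c) st' b2 Q) ->
  halts_within (CWhile e c) st b Q.
Proof.
move=> go lt_b [k1 [st1 [ex1 le1 [k2 [st2 [ex2 le2 Qst2]]]]]].
exists (ecost st e + k1 + k2).+1, st2.
by split=> //; [apply: exec_while_true ex1 ex2 | lia].
Qed.

End CostLogic.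

(** * Polynomial-time functions between encoded types *)

Definition agree_below (n : nat) (st st' : store) : Prop :=
  forall j, j < n -> st' j = st j.

(* The command [C n] reads its argument in, and writes its result to, variable
   [n]; it may overwrite the variables above [n] but no others, so that nested
   computations need no renaming. *)
Definition computes {A B} {eA : Enc A} {eB : Enc B} (f : A -> B)
    (C : nat -> cmd) (b : A -> nat) : Prop :=
  forall n st a, st n = enc a ->
    halts_within (C n) st (b a) (fun st' => st' n = enc (f a) /\ agree_below n st st').

Record ptime {A B} {eA : Enc A} {eB : Enc B} (f : A -> B) : Prop := PTime {
  ptime_program : exists C b, pbounded b /\ computes f C b;
  ptime_esize : pbounded (fun a => esize (f a)) }.

Ltac solve_pbounded := repeat first
  [ assumption
  | match goal with
    | |- pbounded (fun _ => ?n) => exact (pbounded_cst n)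
    | |- pbounded (fun a => addn (@?f a) (@?g a)) => apply: pboundedD
    | |- pbounded (fun a => muln (@?f a) (@?g a)) => apply: pboundedM
    | |- pbounded (fun a => S (@?f a)) => apply: pboundedS
    | |- pbounded esize => exact: pbounded_esize
    | |- pbounded (fun a => esize a) => exact: pbounded_esize
    | |- pbounded (fun a => esize (_ a)) => apply: ptime_esize
    end ].

Lemma upd_eq st x d : upd st x d x = d. Proof. by rewrite /upd eqxx. Qed.
Lemma upd_neq st x d y : y != x -> upd st x d y = st y.
Proof. by rewrite /upd => /negbTE->. Qed.

Definition call (C : nat -> cmd) (m n : nat) : cmd := CSeq (CAssign m (EVar n)) (C m).

Section Combinators.
Context {A : Type} {eA : Enc A}.

Lemma computes_call B (eB : Enc B) (f : A -> B) C b m n st a :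
  computes f C b -> n < m -> st n = enc a ->
  halts_within (call C m n) st (esize a + b a).+1
    (fun st' => st' m = enc (f a) /\ agree_below m st st').
Proof.
move=> Cf lt_nm st_n; apply: (@halts_within_seq (esize a).+1 (b a)) => //.
apply: halts_within_assign; first by rewrite /= st_n addn0.
have := Cf m (upd st m (st n)) a; rewrite upd_eq => /(_ st_n) run.
apply: halts_within_weaken run _ _ => // st' [res frame]; split=> // j lt_jm.
by rewrite frame // upd_neq //; lia.
Qed.

Lemma ptime_recode B B' (eB : Enc B) (eB' : Enc B') (f : A -> B) (f' : A -> B') :
  (forall a, enc (f a) = enc (f' a)) -> ptime f -> ptime f'.
Proof.
move=> eq_enc [[C [b [bb Cf]]] bf]; split; last first.
  by apply: pbounded_le bf => a; rewrite /esize eq_enc.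
by exists C, b; split=> // n st a; rewrite -eq_enc; exact: Cf.
Qed.

Lemma ptime_ext B (eB : Enc B) (f f' : A -> B) : f =1 f' -> ptime f -> ptime f'.
Proof. by move=> eq_f; apply: ptime_recode => a; rewrite eq_f. Qed.

Lemma ptime_id : ptime (fun a : A => a).
Proof.
split; last exact: pbounded_esize.
exists (fun=> CSkip), (fun=> 1); split; first exact: pbounded_cst.
by move=> n st a st_n; exists 1, st; split=> //; exact: exec_skip.
Qed.

Fixpoint const_expr (d : tree) : expr :=
  if d is Node l r then ECons (const_expr l) (const_expr r) else ENil.

Lemma eval_const st d : eval st (const_expr d) = d.
Proof. by elim: d => //= l -> r ->. Qed.

Lemma ecost_const st st' d : ecost st (const_expr d) = ecost st' (const_expr d).
Proof. by elim: d => //= l -> r ->; rewrite !eval_const. Qed.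

Lemma ptime_cst B {eB : Enc B} (b : B) : ptime (fun _ : A => b).
Proof.
split; last exact: pbounded_cst.
pose (e := const_expr (enc b)).
exists (fun n => CAssign n e), (fun=> (ecost (fun=> Leaf) e).+1).
split; first exact: pbounded_cst.
move=> n st a _; apply: halts_within_assign; first by rewrite /e (ecost_const _ st).
by split=> [|j lt_jn]; rewrite ?upd_eq ?eval_const // upd_neq //; lia.
Qed.

Lemma ptime_comp B C (eB : Enc B) (eC : Enc C) (g : B -> C) (f : A -> B) :
  ptime g -> ptime f -> ptime (fun a => g (f a)).
Proof.
move=> [[Cg [bg [bbg run_g]]] sg] [[Cf [bf [bbf run_f]]] sf].
split; last exact: pbounded_comp sg sf.
exists (fun n => CSeq (Cf n) (Cg n)), (fun a => bf a + bg (f a)); split.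
  exact: pboundedD bbf (pbounded_comp bbg sf).
move=> n st a st_n.
apply: halts_within_bind (run_f n st a st_n) (leqnn _) _ => st1 [st1_n frame1].
apply: halts_within_weaken (run_g n st1 (f a) st1_n) _ _ => // st2 [st2_n frame2].
by split=> // j lt_jn; rewrite frame2 ?frame1.
Qed.

Lemma ptime_pair B C (eB : Enc B) (eC : Enc C) (f : A -> B) (g : A -> C) :
  ptime f -> ptime g -> ptime (fun a => (f a, g a)).
Proof.
move=> [[Cf [bf [bbf run_f]]] sf] [[Cg [bg [bbg run_g]]] sg]; split; last first.
  by apply: pbounded_le (pboundedS (pboundedD sf sg)) => a.
pose pair_expr n := ECons (EVar n.+1) (EVar n.+2).
exists (fun n => CSeq (call Cf n.+1 n) (CSeq (call Cg n.+2 n) (CAssign n (pair_expr n)))).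
exists (fun a => 10 + 2 * esize a + bf a + bg a + 2 * (esize (f a) + esize (g a))).
split; first by solve_pbounded.
move=> n st a st_n; set result_cost := 2 * (_ + _).
have run1 := computes_call run_f (ltnSn n) st_n.
apply: (halts_within_bind (b2 := 5 + esize a + bg a + result_cost) run1); first by lia.
move=> st1 [res1 frame1]; have st1_n : st1 n = enc a by rewrite frame1.
have run2 := computes_call run_g (leqW (ltnSn n)) st1_n.
apply: (halts_within_bind (b2 := 4 + result_cost) run2); first by lia.
move=> st2 [res2 frame2].
have st2_n1 : st2 n.+1 = enc (f a) by rewrite frame2.
apply: halts_within_assign; first by rewrite /= st2_n1 res2 /result_cost /esize; lia.
split=> [|j lt_jn]; first by rewrite upd_eq /= st2_n1 res2.
by rewrite upd_neq ?frame2 ?frame1 //; lia.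
Qed.

Lemma ptime_if_node B C (eB : Enc B) (eC : Enc C) (f : A -> B) (g h : A -> C) :
  ptime f -> ptime g -> ptime h ->
  ptime (fun a => if is_node (enc (f a)) then g a else h a).
Proof.
move=> [[Cf [bf [bbf run_f]]] sf] [[Cg [bg [bbg run_g]]] sg].
move=> [[Ch [bh [bbh run_h]]] sh]; split; last first.
  by apply: pbounded_le (pboundedD sg sh) => a; case: ifP; lia.
exists (fun n => CSeq (call Cf n.+1 n) (CIf (EVar n.+1) (Cg n) (Ch n))).
exists (fun a => 2 + esize a + bf a + (esize (f a) + (bg a + bh a))).
split; first by solve_pbounded.
move=> n st a st_n; have run1 := computes_call run_f (ltnSn n) st_n.
apply: (halts_within_bind (b2 := (esize (f a) + (bg a + bh a)).+1) run1); first by lia.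
move=> st1 [res1 frame1].
apply: (@halts_within_if (bg a + bh a)); first by rewrite /= res1 addn0.
have st1_n : st1 n = enc a by rewrite frame1.
have frame st2 : agree_below n st1 st2 -> agree_below n st st2.
  by move=> frame2 j lt_jn; rewrite frame2 ?frame1 ?leqW.
rewrite /= res1; case: ifP => _.
- apply: halts_within_weaken (run_g n st1 a st1_n) (leq_addr _ _) _ => st2 [? /frame].
  by split.
- apply: halts_within_weaken (run_h n st1 a st1_n) (leq_addl _ _) _ => st2 [? /frame].
  by split.
Qed.

Lemma ptime_if B (eB : Enc B) (b : A -> bool) (f g : A -> B) :
  ptime b -> ptime f -> ptime g -> ptime (fun a => if b a then f a else g a).
Proof.
by move=> pb pf pg; apply: ptime_ext (ptime_if_node pb pf pg) => a; case: (b a).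
Qed.

Lemma ptime_expr B (eB : Enc B) (f : A -> B) (e : nat -> expr) c :
  (forall st n (a : A), st n = enc a -> eval st (e n) = enc (f a)) ->
  (forall st n (a : A), st n = enc a -> ecost st (e n) <= c * esize a) ->
  ptime f.
Proof.
move=> eval_e cost_e; split; last first.
  apply: (pbounded_le (h := fun a => c * esize a)); last by solve_pbounded.
  move=> a; apply: leq_trans (cost_e (fun=> enc a) 0 a erefl).
  rewrite /esize -(eval_e (fun=> enc a) 0 a erefl).
  by case: (e 0) => *; rewrite /= leq_addr.
exists (fun n => CAssign n (e n)), (fun a => (c * esize a).+1).
split; first by solve_pbounded.
move=> n st a st_n; apply: halts_within_assign; first by rewrite ltnS cost_e.
split=> [|j lt_jn]; first by rewrite upd_eq (eval_e _ _ _ st_n).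
by rewrite upd_neq //; lia.
Qed.

End Combinators.

Definition left_subtree (d : tree) : tree := if d is Node l _ then l else Leaf.
Definition right_subtree (d : tree) : tree := if d is Node _ r then r else Leaf.

Section Projections.
Context {A : Type} {eA : Enc A}.

Lemma ptime_left B C (eB : Enc B) (eC : Enc C) (g : B -> C) (f : A -> B) :
  (forall b, enc (g b) = left_subtree (enc b)) -> ptime f -> ptime (fun a => g (f a)).
Proof.
move=> enc_g; apply: ptime_comp; apply: (@ptime_expr _ _ _ _ _ (fun n => EHd (EVar n)) 2).
- by move=> st n b /= ->; rewrite enc_g.
- by move=> st n b /= ->; rewrite /esize; case: (enc b) => //= *; lia.
Qed.

Lemma ptime_right B C (eB : Enc B) (eC : Enc C) (g : B -> C) (f : A -> B) :
  (forall b, enc (g b) = right_subtree (enc b)) -> ptime f -> ptime (fun a => g (f a)).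
Proof.
move=> enc_g; apply: ptime_comp; apply: (@ptime_expr _ _ _ _ _ (fun n => ETl (EVar n)) 2).
- by move=> st n b /= ->; rewrite enc_g.
- by move=> st n b /= ->; rewrite /esize; case: (enc b) => //= *; lia.
Qed.

Lemma ptime_fst B C (eB : Enc B) (eC : Enc C) (f : A -> B * C) :
  ptime f -> ptime (fun a => (f a).1).
Proof. exact: ptime_left. Qed.

Lemma ptime_snd B C (eB : Enc B) (eC : Enc C) (f : A -> B * C) :
  ptime f -> ptime (fun a => (f a).2).
Proof. exact: ptime_right. Qed.

Lemma ptime_head (f : A -> seq bool) : ptime f -> ptime (fun a => head false (f a)).
Proof. by apply: ptime_left => -[]. Qed.

Lemma ptime_behead B (eB : Enc B) (f : A -> seq B) :
  ptime f -> ptime (fun a => behead (f a)).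
Proof. by apply: ptime_right => -[]. Qed.

Lemma ptime_cons B (eB : Enc B) (f : A -> B) (g : A -> seq B) :
  ptime f -> ptime g -> ptime (fun a => f a :: g a).
Proof. by move=> pf pg; apply: ptime_recode (ptime_pair pf pg). Qed.

Lemma ptime_Some B (eB : Enc B) (f : A -> B) : ptime f -> ptime (fun a => Some (f a)).
Proof. by move=> pf; apply: ptime_recode (ptime_pair (ptime_cst tt) pf). Qed.

Lemma ptime_Node (f g : A -> tree) :
  ptime f -> ptime g -> ptime (fun a => Node (f a) (g a)).
Proof. by move=> pf pg; apply: ptime_recode (ptime_pair pf pg). Qed.

Lemma ptime_eq (f g : A -> tree) : ptime f -> ptime g -> ptime (fun a => f a == g a).
Proof.
move=> pf pg.
apply: (ptime_comp (g := fun p : tree * tree => p.1 == p.2) _ (ptime_pair pf pg)).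
apply: (@ptime_expr _ _ _ _ _ (fun n => EEq (EHd (EVar n)) (ETl (EVar n))) 7).
- by move=> st n [x y] /= ->.
- move=> st n [x y] /= ->; rewrite /esize /enc /enc_prod /= /enc /enc_tree.
  by case: tree_eqb => /=; have := tree_size_gt0 x; have := tree_size_gt0 y; lia.
Qed.

Lemma ptime_and (f g : A -> bool) : ptime f -> ptime g -> ptime (fun a => f a && g a).
Proof. by move=> pf pg; exact: (ptime_if pf pg (ptime_cst false)). Qed.

Lemma ptime_or (f g : A -> bool) : ptime f -> ptime g -> ptime (fun a => f a || g a).
Proof. by move=> pf pg; exact: (ptime_if pf (ptime_cst true) pg). Qed.

Lemma ptime_neg (f : A -> bool) : ptime f -> ptime (fun a => ~~ f a).
Proof. by move=> pf; exact: (ptime_if pf (ptime_cst false) (ptime_cst true)). Qed.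

Lemma ptime_addb (f g : A -> bool) : ptime f -> ptime g -> ptime (fun a => f a (+) g a).
Proof.
by move=> pf pg; apply: ptime_ext (ptime_if pf (ptime_neg pg) pg) => a; case: (f a).
Qed.

Lemma ptime_nilp B (eB : Enc B) (f : A -> seq B) : ptime f -> ptime (fun a => nilp (f a)).
Proof.
move=> pf; apply: ptime_ext (ptime_if_node pf (ptime_cst false) (ptime_cst true)) => a.
by case: (f a).
Qed.

(* The unused payload of a [None] must still be typed, hence [b0]. *)
Lemma ptime_option B C (eB : Enc B) (eC : Enc C) (b0 : B) (f : A -> option B)
    (g : A -> B -> C) (h : A -> C) :
  ptime f -> ptime (fun q : A * B => g q.1 q.2) -> ptime h ->
  ptime (fun a => if f a is Some b then g a b else h a).
Proof.
move=> pf pg ph.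
have p_payload : ptime (fun a => odflt b0 (f a)).
  pose payload o := right_subtree (@enc _ (enc_option eB) o).
  have p_right : ptime (fun a => payload (f a)) by exact: (ptime_right (g := payload)).
  apply: ptime_recode (ptime_if_node pf p_right (ptime_cst (enc b0))) => a.
  by rewrite /payload; case: (f a).
have := ptime_if_node pf (ptime_comp pg (ptime_pair ptime_id p_payload)) ph.
by apply: ptime_ext => a /=; case: (f a).
Qed.

Lemma ptime_comp2 B C D (eB : Enc B) (eC : Enc C) (eD : Enc D) (F : B -> C -> D)
    (f : A -> B) (g : A -> C) :
  ptime (fun q : B * C => F q.1 q.2) -> ptime f -> ptime g ->
  ptime (fun a => F (f a) (g a)).
Proof. by move=> pF pf pg; apply: ptime_comp pF (ptime_pair pf pg). Qed.

End Projections.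

(* The accumulator and the rest of the list live in the variables [n.+1] and
   [n.+2]; the step is called on the triple built in [n.+3]. *)
Definition fold_body (C : nat -> cmd) (n : nat) : cmd :=
  CSeq (CAssign n.+3 (ECons (EVar n) (ECons (EVar n.+1) (EHd (EVar n.+2)))))
    (CSeq (C n.+3) (CSeq (CAssign n.+1 (EVar n.+3)) (CAssign n.+2 (ETl (EVar n.+2))))).

Section Fold.
Context {A S E : Type} {eA : Enc A} {eS : Enc S} {eE : Enc E}.
Variable step : A -> S -> E -> S.

Section Loop.
Variables (C : nat -> cmd) (b : A * (S * E) -> nat).
Hypothesis C_step : computes (fun q : A * (S * E) => step q.1 q.2.1 q.2.2) C b.

Let body_cost a s x (r : seq E) : nat :=
  20 + 3 * (esize a + esize s + esize (step a s x)) + 6 * esize (x :: r) + b (a, (s, x)).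

Lemma fold_body_step n st a s x r :
  st n = enc a -> st n.+1 = enc s -> st n.+2 = Node (enc x) (enc r) ->
  halts_within (fold_body C n) st (body_cost a s x r) (fun st' =>
    [/\ st' n.+1 = enc (step a s x), st' n.+2 = enc r & agree_below n.+1 st st']).
Proof.
move=> st_n st_n1 st_n2; rewrite /body_cost.
set size_step := esize (step a s x); set size_list := esize (x :: r).
apply: (@halts_within_seq (10 + 3 * (esize a + esize s) + 4 * size_list)
  (b (a, (s, x)) + (10 + size_step + 2 * size_list))).
  by rewrite /size_step /size_list; lia.
apply: halts_within_assign.
  by rewrite /= st_n st_n1 st_n2 /size_list esize_cons /esize /=; lia.
rewrite /= st_n st_n1 st_n2 /=; set st1 := upd _ _ _.
apply: halts_within_bind (C_step (a := (a, (s, x))) (upd_eq _ _ _)) (leqnn _) _ => st2.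
rewrite -/st1 => -[/= res2 frame2].
have st2E j : j < n.+3 -> st2 j = st j.
  by move=> lt_j; rewrite frame2 // /st1 upd_neq //; lia.
apply: (@halts_within_seq size_step.+1 (9 + 2 * size_list)); first by lia.
apply: halts_within_assign; first by rewrite /= res2 addn0.
have st3_n2 : upd st2 n.+1 (eval st2 (EVar n.+3)) n.+2 = Node (enc x) (enc r).
  by rewrite upd_neq ?st2E // eqn_leq ltnn.
apply: halts_within_assign.
  by rewrite /= in st3_n2 *; rewrite st3_n2 /size_list esize_cons /esize /=; lia.
split=> [||j lt_j].
- by rewrite upd_neq ?upd_eq // eqn_leq ltnn andbF.
- by rewrite upd_eq /= in st3_n2 *; rewrite st3_n2.
- by rewrite !upd_neq ?st2E //; lia.
Qed.

Lemma fold_loop B W n a r s st :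
  st n = enc a -> st n.+1 = enc s -> st n.+2 = enc r ->
  (forall i, esize (foldl (step a) s (take i r)) <= B) ->
  (forall s' x, esize s' <= B -> esize x <= esize r -> b (a, (s', x)) <= W) ->
  halts_within (CWhile (EVar n.+2) (fold_body C n)) st
    ((size r).+1 * (30 + 3 * esize a + 6 * B + 8 * esize r + W))
    (fun st' => st' n.+1 = enc (foldl (step a) s r) /\ agree_below n st st').
Proof.
elim: r s st => [|x r IH] s st st_n st_n1 st_n2 le_B le_W.
  by apply: halts_within_while_false; rewrite /= ?st_n2 //= ?mul1n; lia.
have le_s : esize s <= B by have := le_B 0.
have le_step : esize (step a s x) <= B by have := le_B 1; rewrite /= take0.
have le_b : b (a, (s, x)) <= W by apply: le_W => //; rewrite esize_cons; lia.
set budget := 30 + _ + _ + _ + W.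
apply: (@halts_within_while_true (body_cost a s x r)
  ((size r).+1 * (30 + 3 * esize a + 6 * B + 8 * esize r + W))).
- by rewrite /= st_n2.
- apply: (@leq_trans (budget + (size r).+1 * budget)); last by rewrite mulSn.
  rewrite -addSn leq_add //; last first.
    by rewrite leq_mul2l /budget esize_cons; apply/orP; right; lia.
  have -> : ecost st (EVar n.+2) = esize (x :: r) by rewrite /= st_n2 addn0.
  by rewrite /budget /body_cost; lia.
apply: halts_within_weaken (fold_body_step st_n st_n1 st_n2) _ _ => // st1 [res1 rest1 frame1].
apply: halts_within_weaken (IH _ _ _ res1 rest1 _ _) _ _ => //.
- by rewrite frame1.
- by move=> i; have := le_B i.+1.
- by move=> s' y le_s' le_y; apply: le_W; rewrite // esize_cons; lia.
by move=> st2 [res2 frame2]; split=> // j lt_jn; rewrite frame2 // frame1 // ltnW.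
Qed.

End Loop.

Variables (init : A -> S) (l : A -> seq E).

Lemma ptime_foldl (M : A -> nat) :
  ptime (fun q : A * (S * E) => step q.1 q.2.1 q.2.2) -> ptime init -> ptime l ->
  pbounded M ->
  (forall a i, esize (foldl (step a) (init a) (take i (l a))) <= M a) ->
  ptime (fun a => foldl (step a) (init a) (l a)).
Proof.
move=> [[C [b [bb run_step]]] _] [[Ci [bi [bbi run_i]]] si].
move=> [[Cl [bl [bbl run_l]]] sl] bM le_M.
split; last first.
  by apply: pbounded_le bM => a; have := le_M a (size (l a)); rewrite take_size.
have bm : pbounded (fun a => 2 + esize a + M a + esize (l a)) by solve_pbounded.
have [W bW le_W] := pbounded_uniform bb bm.
pose (loop_cost := fun a =>
  (esize (l a)).+1 * (30 + 3 * esize a + 6 * M a + 8 * esize (l a) + W a)).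
exists (fun n => CSeq (call Ci n.+1 n) (CSeq (call Cl n.+2 n)
  (CSeq (CWhile (EVar n.+2) (fold_body C n)) (CAssign n (EVar n.+1))))).
exists (fun a => (esize a + bi a).+1 + ((esize a + bl a).+1 + (loop_cost a + (M a).+1))).
split; first by rewrite /loop_cost; solve_pbounded.
move=> n st a st_n; have run1 := computes_call run_i (ltnSn n) st_n.
apply: halts_within_bind run1 (leqnn _) _ => st1 [res1 frame1].
have st1_n : st1 n = enc a by rewrite frame1.
have run2 := computes_call run_l (leqW (ltnSn n)) st1_n.
apply: halts_within_bind run2 (leqnn _) _ => st2 [res2 frame2].
apply: halts_within_seq (leqnn _) _.
apply: halts_within_weaken (fold_loop run_step _ _ res2 (le_M a) _) _ _.
- by rewrite !frame2 ?frame1 // leqW.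
- by rewrite frame2.
- by move=> s x le_s le_x; apply: (le_W a); rewrite !esize_pair /=; lia.
- by rewrite leq_mul2r ltnS size_le_esize orbT.
move=> st3 [res3 frame3]; apply: halts_within_assign.
  by rewrite /= res3 addn0 ltnS; have := le_M a (size (l a)); rewrite take_size.
split=> [|j lt_jn]; first by rewrite upd_eq.
by rewrite upd_neq ?frame3 ?frame2 ?frame1 //; lia.
Qed.

Lemma ptime_foldl_additive (m : S -> nat) k (g : A -> nat) :
  (forall s, esize s <= k * (m s).+1) ->
  (forall a s e, m (step a s e) <= m s + g a * esize e) ->
  pbounded (fun a => m (init a)) -> pbounded g ->
  ptime (fun q : A * (S * E) => step q.1 q.2.1 q.2.2) -> ptime init -> ptime l ->
  ptime (fun a => foldl (step a) (init a) (l a)).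
Proof.
move=> le_m m_step bm bg p_step p_init p_l.
apply: (ptime_foldl (M := fun a => k * (m (init a) + g a * esize (l a)).+1)) => //.
  by solve_pbounded.
move=> a i; apply: leq_trans (le_m _) _; rewrite leq_mul2l ltnS; apply/orP; right.
elim: (l a) (init a) i => [|x r IH] s [|i] //=; try lia.
apply: leq_trans (IH _ _) _; rewrite esize_cons.
by have := m_step a s x; rewrite -addn1 !mulnDr; lia.
Qed.

End Fold.

Lemma iter_foldl S U (step : S -> S) s (u : seq U) :
  iter (size u) step s = foldl (fun s' _ => step s') s u.
Proof. by elim: u s => //= x u IH s; rewrite -iterS iterSr IH. Qed.

Lemma ptime_iter A S U (eA : Enc A) (eS : Enc S) (eU : Enc U) (step : A -> S -> S)
    (init : A -> S) (u : A -> seq U) (M : A -> nat) :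
  ptime (fun q : A * S => step q.1 q.2) -> ptime init -> ptime u -> pbounded M ->
  (forall a i, i <= size (u a) -> esize (iter i (step a) (init a)) <= M a) ->
  ptime (fun a => iter (size (u a)) (step a) (init a)).
Proof.
move=> p_step p_init p_u bM le_M.
apply: ptime_ext (fun a => esym (iter_foldl _ _ (u a))) _.
apply: (ptime_foldl (step := fun a s (_ : U) => step a s) (M := M)) => //.
  apply: (ptime_comp2 (F := step) p_step); first exact/ptime_fst/ptime_id.
  exact/ptime_fst/ptime_snd/ptime_id.
by move=> a i; rewrite -iter_foldl le_M // size_take_min geq_minr.
Qed.

Section Concatenation.
Context {A E : Type} {eA : Enc A} {eE : Enc E}.

Lemma ptime_catrev (l l' : A -> seq E) :
  ptime l -> ptime l' -> ptime (fun a => catrev (l a) (l' a)).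
Proof.
move=> p_l p_l'; pose push (a : A) := fun (s : seq E) e => e :: s.
apply: (ptime_ext (f := fun a => foldl (push a) (l' a) (l a))).
  by move=> a; elim: (l a) (l' a) => //= x s IH s'; rewrite IH.
apply: (ptime_foldl_additive (m := esize) (k := 1) (g := fun=> 2)) => //.
- by move=> s; lia.
- move=> a s e; have : 0 < esize e by exact: esize_gt0.
  by rewrite /push esize_cons /=; lia.
- by solve_pbounded.
- by solve_pbounded.
- apply: ptime_cons; first exact/ptime_snd/ptime_snd/ptime_id.
  exact/ptime_fst/ptime_snd/ptime_id.
Qed.

Lemma ptime_rev (l : A -> seq E) : ptime l -> ptime (fun a => rev (l a)).
Proof. by move=> p_l; apply: ptime_catrev p_l (ptime_cst [::]). Qed.

Lemma ptime_cat (l l' : A -> seq E) :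
  ptime l -> ptime l' -> ptime (fun a => l a ++ l' a).
Proof.
move=> p_l p_l'; apply: ptime_ext (ptime_catrev (ptime_rev p_l) p_l') => a.
by rewrite catrevE revK.
Qed.

End Concatenation.

Section Lists.
Context {A E F : Type} {eA : Enc A} {eE : Enc E} {eF : Enc F}.

Lemma ptime_map (f : A -> E -> F) (l : A -> seq E) :
  ptime (fun q : A * E => f q.1 q.2) -> ptime l -> ptime (fun a => map (f a) (l a)).
Proof.
move=> p_f p_l; pose step (a : A) := fun (s : seq F) e => f a e :: s.
have foldlE a r s : foldl (step a) r s = catrev (map (f a) s) r.
  by elim: s r => //= x s IH r; rewrite IH.
apply: (ptime_ext (f := fun a => rev (foldl (step a) [::] (l a)))).
  by move=> a; rewrite foldlE -/(rev _) revK.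
have b_in : pbounded (fun a => esize a + esize (l a) + 1) by solve_pbounded.
have [h b_h le_h] := pbounded_uniform (ptime_esize p_f) b_in.
apply/ptime_rev/(ptime_foldl (M := fun a => (esize (l a) * (h a).+1).+1)) => //.
- apply: ptime_cons; last by apply/ptime_fst/ptime_snd/ptime_id.
  apply: (ptime_comp2 p_f); first by apply/ptime_fst/ptime_id.
  by apply/ptime_snd/ptime_snd/ptime_id.
- exact: ptime_cst.
- by solve_pbounded.
move=> a i; rewrite foldlE -/(rev _) esize_rev.
have le_values : all (fun e => esize e <= h a) (map (f a) (take i (l a))).
  rewrite all_map; apply: sub_all (all_esize_take i (l a)) => e le_e.
  by apply: (le_h a (a, e)); rewrite esize_pair; lia.
apply: leq_trans (esize_seq_le le_values) _.
by rewrite ltnS leq_mul2r size_map size_take_le_esize orbT.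
Qed.

Lemma ptime_flatten (l : A -> seq (seq E)) : ptime l -> ptime (fun a => flatten (l a)).
Proof.
move=> p_l; pose step (a : A) := fun acc (s : seq E) => catrev s acc.
apply: (ptime_ext (f := fun a => rev (foldl (step a) [::] (l a)))).
  move=> a; suff foldlE acc : foldl (step a) acc (l a) = catrev (flatten (l a)) acc.
    by rewrite foldlE -/(rev _) revK.
  by elim: (l a) acc => //= s ss IH acc; rewrite IH /step !catrevE rev_cat catA.
apply/ptime_rev/(ptime_foldl_additive (m := esize) (k := 1) (g := fun=> 1)) => //.
- by move=> s; lia.
- by move=> a acc s; rewrite /step mul1n addnC -esize_catrev.
- by solve_pbounded.
- by solve_pbounded.
- apply: ptime_catrev; first exact/ptime_snd/ptime_snd/ptime_id.
  exact/ptime_fst/ptime_snd/ptime_id.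
- exact: ptime_cst.
Qed.

Lemma ptime_has (p : A -> E -> bool) (l : A -> seq E) :
  ptime (fun q : A * E => p q.1 q.2) -> ptime l -> ptime (fun a => has (p a) (l a)).
Proof.
move=> p_p p_l; pose step a := fun b e => b || p a e.
have foldlE a b s : foldl (step a) b s = b || has (p a) s.
  by elim: s b => [|x s IH] b /=; rewrite ?orbF // IH orbA.
apply: (ptime_ext (f := fun a => foldl (step a) false (l a))) => //.
apply: (ptime_foldl (M := fun=> 3)) => //.
- apply: ptime_or; first by apply/ptime_fst/ptime_snd/ptime_id.
  apply: (ptime_comp2 p_p); first by apply/ptime_fst/ptime_id.
  by apply/ptime_snd/ptime_snd/ptime_id.
- exact: ptime_cst.
- exact: pbounded_cst.
- by move=> a i; exact: esize_bool.
Qed.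

End Lists.

Lemma ptime_mem A (eA : Enc A) (f : A -> tree) (l : A -> seq tree) :
  ptime f -> ptime l -> ptime (fun a => f a \in l a).
Proof.
move=> p_f p_l; apply: (ptime_comp2 (F := fun x (s : seq tree) => x \in s) _ p_f p_l).
apply: (ptime_ext (f := fun q => has (fun y => y == q.1) q.2)).
  by move=> q; rewrite -has_pred1.
apply: ptime_has; last exact/ptime_snd/ptime_id.
by apply: ptime_eq; [apply/ptime_snd/ptime_id | apply/ptime_fst/ptime_fst/ptime_id].
Qed.

Ltac ptime_extra := fail.
Ltac ptime_step := match goal with
  | |- ptime (fun x => x) => exact: ptime_id
  | |- ptime fst => exact: (ptime_fst ptime_id)
  | |- ptime snd => exact: (ptime_snd ptime_id)
  | |- ptime (fun _ => ?c) => exact: (ptime_cst c)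
  | |- ptime (fun x => (@?f x, @?g x)) => apply: ptime_pair
  | |- ptime (fun x => fst (@?f x)) => apply: ptime_fst
  | |- ptime (fun x => snd (@?f x)) => apply: ptime_snd
  | |- ptime (fun x => cons (@?f x) (@?g x)) => apply: ptime_cons
  | |- ptime (fun x => head false (@?f x)) => apply: ptime_head
  | |- ptime (fun x => behead (@?f x)) => apply: ptime_behead
  | |- ptime (fun x => Some (@?f x)) => apply: ptime_Some
  | |- ptime (fun x => Node (@?f x) (@?g x)) => apply: ptime_Node
  | |- ptime (fun x => @?f x == @?g x) => apply: ptime_eq
  | |- ptime (fun x => @?f x \in @?g x) => apply: ptime_mem
  | |- ptime (fun x => andb (@?f x) (@?g x)) => apply: ptime_and
  | |- ptime (fun x => orb (@?f x) (@?g x)) => apply: ptime_or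
  | |- ptime (fun x => addb (@?f x) (@?g x)) => apply: ptime_addb
  | |- ptime (fun x => negb (@?f x)) => apply: ptime_neg
  | |- ptime (fun x => nilp (@?f x)) => apply: ptime_nilp
  | |- ptime (fun x => rev (@?f x)) => apply: ptime_rev
  | |- ptime (fun x => map _ _) => apply: ptime_map
  | |- ptime (fun x => cat (@?f x) (@?g x)) => apply: ptime_cat
  | |- ptime (fun x => flatten _) => apply: ptime_flatten
  | |- ptime (fun x => has _ _) => apply: ptime_has
  end.
Ltac solve_ptime :=
  cbv beta zeta; repeat first [assumption | ptime_step | ptime_extra | apply: ptime_if].

Lemma ptime_polytime A B (eA : Enc A) (eB : Enc B) (F : A -> B) (J : Type) (O : J -> Type)
    (encJ : J -> tree) (encO : forall j, O j -> tree) (f : forall j, O j) (input : J -> A) :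
  ptime F -> (forall j, enc (input j) = encJ j) ->
  (forall j, enc (F (input j)) = encO j (f j)) -> polytime encJ encO f.
Proof.
move=> [[C [b [[e b_le] run]]] _] enc_input enc_output.
exists (C 0), (('X + 2%:P) ^+ e)%R => j.
have st0 : upd (fun=> Leaf) 0 (encJ j) 0 = enc (input j) by rewrite upd_eq enc_input.
have [k [st [exec_C le_b [st_0 _]]]] := run 0 _ _ st0.
exists k; first by exists st; rewrite ?st_0 ?enc_output.
apply: leq_trans le_b (leq_trans (b_le _) _).
by rewrite /esize enc_input horner_exp hornerD hornerX hornerC natrXE.
Qed.

(** * Binary arithmetic *)

(* Least significant bit first; leading zeros are allowed. *)
Definition bval (b : seq bool) : nat := foldr (fun (x : bool) n => x + n.*2) 0 b.

Lemma bval_rcons b (x : bool) : bval (rcons b x) = bval b + 2 ^ size b * x.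
Proof. by elim: b => [|y b IH] /=; rewrite ?mul1n ?addn0 // IH expnS; lia. Qed.

Lemma bval_lt b : bval b < 2 ^ size b.
Proof. by elim: b => //= x b IH; rewrite expnS; lia. Qed.

Lemma bval_eq0 b : (bval b == 0) = ~~ has id b.
Proof. by elim: b => //= x b IH; case: x => //=; rewrite -IH; lia. Qed.

Lemma bval_head_behead b : bval b = head false b + (bval (behead b)).*2.
Proof. by case: b. Qed.

Lemma esize_bits (b : seq bool) : esize b <= 4 * (size b).+1.
Proof.
elim: b => //= x b IH; have : esize x <= 3 by exact: esize_bool.
by rewrite esize_cons; lia.
Qed.

Definition majority (x y z : bool) : bool := (x && (y || z)) || (y && z).

(* The carry, the unread digits of the second operand, and the digits already
   computed, last one first; [x] is the next digit of the first operand.  With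
   [borrow] the second operand is subtracted instead of added. *)
Definition ripple_step (borrow : bool) (s : bool * seq bool * seq bool) (x : bool) :=
  (majority (borrow (+) x) (head false s.1.2) s.1.1, behead s.1.2,
   (x (+) head false s.1.2 (+) s.1.1) :: s.2).

Definition ripple borrow s a := foldl (ripple_step borrow) s a.

Lemma full_adderE (borrow x y z : bool) :
  ((x (+) y (+) z)%:Z + (-1) ^+ borrow * (majority (borrow (+) x) y z).*2%:Z
  = x%:Z + (-1) ^+ borrow * (y + z)%N%:Z)%R.
Proof. by case: borrow x y z => [] [] [] []. Qed.

Lemma size_ripple borrow s a :
  size (ripple borrow s a).2 = size s.2 + size a /\
  size (ripple borrow s a).1.2 = size s.1.2 - size a.
Proof.
rewrite /ripple; elim: a s => [|x a IH] s /=; first by rewrite addn0 subn0.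
by have [-> ->] := IH (ripple_step borrow s x); rewrite /= size_behead; lia.
Qed.

Lemma rippleE borrow s a (r := ripple borrow s a) :
  ((bval (rev r.2))%:Z + (-1) ^+ borrow * (2 ^ size r.2 * (bval r.1.2 + r.1.1))%N%:Z =
   (bval (rev s.2))%:Z +
     (2 ^ size s.2)%N%:Z * ((bval a)%:Z + (-1) ^+ borrow * (bval s.1.2 + s.1.1)%N%:Z))%R.
Proof.
rewrite /r /ripple; elim: a s {r} => [|x a IH] [[c b] acc] /=; first by rewrite PoszM; ring.
rewrite IH /ripple_step /= rev_cons bval_rcons size_rev expnS mul2n.
have := full_adderE borrow x (head false b) c.
rewrite [bval b]bval_head_behead -!addnn !PoszD !PoszM.
move: (2 ^ size acc)%N ((-1) ^+ borrow)%R => p sign.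
by move=> /(canRL (addrK _)) ->; ring.
Qed.

Definition bsub a b := rev (ripple true (false, b, [::]) a).2.

Definition blt a b :=
  (ripple true (false, b, [::]) a).1.1 || has id (ripple true (false, b, [::]) a).1.2.

(* After the digits of [a] are used up, only the carry remains to be added to
   the rest of [b]. *)
Definition badd a b :=
  let r := ripple false (false, b, [::]) a in
  let r' := ripple false (r.1.1, [::], r.2) r.1.2 in
  rev (r'.1.1 :: r'.2).

Definition bmul a b :=
  foldl (fun acc (x : bool) => if x then badd (false :: acc) b else false :: acc)
    [::] (rev a).

Lemma size_bsub a b : size (bsub a b) = size a.
Proof. by rewrite size_rev; have [-> _] := size_ripple true (false, b, [::]) a. Qed.

Lemma bsub_borrowE a b (r := ripple true (false, b, [::]) a) :
  bval a + 2 ^ size a * (bval r.1.2 + r.1.1) = bval (bsub a b) + bval b.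
Proof.
have := rippleE true (false, b, [::]) a; rewrite /bsub /= -/r.
by have [-> _] := size_ripple true (false, b, [::]) a; rewrite /= add0n; lia.
Qed.

Lemma bltE a b : blt a b = (bval a < bval b).
Proof.
have := bsub_borrowE a b; have := bval_lt (bsub a b); rewrite size_bsub /blt.
set r := ripple _ _ _; have := bval_eq0 r.1.2.
move: (bval r.1.2) (r.1.1) (has id _) (2 ^ size a) => v c h p.
by case: c; case: h => /=; case: eqP => [->|] //=; nia.
Qed.

Lemma bsubE a b : bval b <= bval a -> bval (bsub a b) = bval a - bval b.
Proof.
have := bsub_borrowE a b; have := bval_lt (bsub a b); rewrite size_bsub /=.
by set r := ripple _ _ _; case: (bval r.1.2 + r.1.1) (2 ^ size a) => [|n] p; nia.
Qed.

Lemma baddE a b : bval (badd a b) = bval a + bval b.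
Proof.
rewrite /badd rev_cons bval_rcons size_rev /=; set r := ripple _ _ a.
have := rippleE false (r.1.1, [::], r.2) r.1.2; have := rippleE false (false, b, [::]) a.
have [_] := size_ripple false (r.1.1, [::], r.2) r.1.2; rewrite -/r /=.
set r' := ripple _ _ _; move/size0nil=> -> /=; rewrite !expr0 add0n !addn0 !mul1r.
by rewrite PoszM PoszD; lia.
Qed.

Lemma size_badd a b : size (badd a b) = (maxn (size a) (size b)).+1.
Proof.
rewrite /badd size_rev /=; set r := ripple _ _ a.
have [-> _] := size_ripple false (r.1.1, [::], r.2) r.1.2.
by have [-> ->] := size_ripple false (false, b, [::]) a => /=; lia.
Qed.

Lemma bmulE a b : bval (bmul a b) = bval a * bval b.
Proof.
rewrite /bmul foldl_rev; elim: a => //= x a IH.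
by case: x; rewrite ?baddE /= IH; lia.
Qed.

Lemma size_bmul a b : size (bmul a b) <= size b + 2 * size a.
Proof.
rewrite /bmul foldl_rev; elim: a => //= x a IH.
by case: x; rewrite ?size_badd /=; lia.
Qed.

Section PtimeArithmetic.
Context {A : Type} {eA : Enc A}.
Implicit Types f g : A -> seq bool.

Lemma ptime_ripple borrow (s : A -> bool * seq bool * seq bool) f :
  ptime s -> ptime f -> ptime (fun a => ripple borrow (s a) (f a)).
Proof.
move=> ps pf; apply: (ptime_foldl_additive (step := fun _ => ripple_step borrow)
  (m := esize) (k := 1) (g := fun=> 6)) => //; first by move=> s'; lia.
- move=> a [[c b] acc] x; have [x_gt0 c_gt0] : 0 < esize x /\ 0 < esize c.
    by split; exact: esize_gt0.
  rewrite /ripple_step; move: (majority _ _ _) (x (+) _ (+) _) => z d.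
  have := esize_bool z; have := esize_bool d.
  by case: b => [|y b]; rewrite !esize_pair /= !esize_cons; lia.
- by solve_pbounded.
- by solve_pbounded.
- by rewrite /ripple_step /majority; solve_ptime.
Qed.

Lemma ptime_bsub f g : ptime f -> ptime g -> ptime (fun a => bsub (f a) (g a)).
Proof. by move=> pf pg; apply/ptime_rev/ptime_snd/ptime_ripple => //; solve_ptime. Qed.

Lemma ptime_blt f g : ptime f -> ptime g -> ptime (fun a => blt (f a) (g a)).
Proof.
move=> pf pg.
have p_run : ptime (fun a => ripple true (false, g a, [::]) (f a)).
  by apply: ptime_ripple; solve_ptime.
by rewrite /blt; solve_ptime.
Qed.

Lemma ptime_badd f g : ptime f -> ptime g -> ptime (fun a => badd (f a) (g a)).
Proof.
move=> pf pg.
have p_run : ptime (fun a => ripple false (false, g a, [::]) (f a)).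
  by apply: ptime_ripple; solve_ptime.
rewrite /badd /=.
have p_carry : ptime (fun a => let r := ripple false (false, g a, [::]) (f a) in
    ripple false (r.1.1, [::], r.2) r.1.2).
  by apply: ptime_ripple; solve_ptime.
by solve_ptime.
Qed.

End PtimeArithmetic.

Lemma ptime_bmul A (eA : Enc A) (f g : A -> seq bool) :
  ptime f -> ptime g -> ptime (fun a => bmul (f a) (g a)).
Proof.
move=> pf pg; apply: (ptime_comp2 _ pf pg) => /=; rewrite /bmul.
pose step (q : seq bool * seq bool) acc (x : bool) :=
  if x then badd (false :: acc) q.2 else false :: acc.
apply: (ptime_foldl (step := step) (init := fun=> [::]) (l := fun q => rev q.1)
  (M := fun q => 4 * (esize q.2 + 2 * esize q.1).+1)).
- rewrite /step; apply: ptime_if; [by solve_ptime| |by solve_ptime].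
  by apply: ptime_badd; solve_ptime.
- by solve_ptime.
- by solve_ptime.
- by solve_pbounded; solve_ptime.
- move=> [a b] i; apply: leq_trans (esize_bits _) _; rewrite leq_mul2l ltnS /=.
  rewrite -[take i (rev a)]revK; apply: leq_trans (size_bmul _ b) _.
  by rewrite leq_add ?size_le_esize // leq_mul2l size_rev -(esize_rev a) size_take_le_esize.
Qed.

Ltac ptime_extra ::= match goal with
  | |- ptime (fun x => bsub (@?f x) (@?g x)) => apply: ptime_bsub
  | |- ptime (fun x => badd (@?f x) (@?g x)) => apply: ptime_badd
  | |- ptime (fun x => blt (@?f x) (@?g x)) => apply: ptime_blt
  | |- ptime (fun x => bmul (@?f x) (@?g x)) => apply: ptime_bmul
  end.

(** * Network flows *)

Section NetworkFlows.
Local Open Scope ring_scope.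
Context {V : Type} {A : finType}.
Variables (tail head : A -> V).
Implicit Types (s t : V) (w cap g h : A -> nat) (p : V -> int) (X : pred V) (k : nat).

Definition leaving X (a : A) : bool := X (tail a) && ~~ X (head a).

(* Quantifying over all potentials [p] packages flow conservation and the
   value [k] in one equation. *)
Definition is_flow s t g k : Prop :=
  forall p, \sum_a (g a)%:Z * (p (head a) - p (tail a)) = k%:Z * (p t - p s).

Definition flow_cost w g : nat := \sum_a g a * w a.

Definition min_cost_flow s t w cap k g : Prop :=
  [/\ is_flow s t g k, (forall a, g a <= cap a)%N
    & forall h, is_flow s t h k -> (forall a, h a <= cap a)%N ->
        (flow_cost w g <= flow_cost w h)%N].

Lemma sum_Posz (P : pred A) g : (\sum_(a | P a) g a)%N%:Z = \sum_(a | P a) (g a)%:Z.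
Proof. exact: (big_morph Posz PoszD). Qed.

Lemma flow_across_cut s t g k X : is_flow s t g k -> X s -> ~~ X t ->
  (\sum_(a | leaving X a) g a = k + \sum_(a | leaving (predC X) a) g a)%N.
Proof.
move=> flow_g Xs Xt; apply/eqP; rewrite -eqz_nat PoszD -subr_eq; apply/eqP.
have := flow_g (fun v => (~~ X v)%:Z); rewrite Xs Xt subr0 mulr1 => <-.
rewrite !sum_Posz [X in X - _]big_mkcond [X in _ - X]big_mkcond -sumrB /=.
apply: eq_bigr => a _; rewrite /leaving /=.
by case: (X (tail a)); case: (X (head a)); rewrite /= ?subrr ?mulr0; lia.
Qed.

Lemma flow_le_cut s t g k X :
  is_flow s t g k -> X s -> ~~ X t -> (k <= \sum_(a | leaving X a) g a)%N.
Proof. by move=> flow_g Xs Xt; rewrite (flow_across_cut flow_g Xs Xt) leq_addr. Qed.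

Lemma complementary_slackness s t w cap k g p :
  is_flow s t g k -> (forall a, g a <= cap a)%N ->
  (forall a, (0 < g a)%N -> (w a)%:Z + p (tail a) <= p (head a)) ->
  (forall a, (g a < cap a)%N -> p (head a) <= (w a)%:Z + p (tail a)) ->
  min_cost_flow s t w cap k g.
Proof.
move=> flow_g g_cap slack_used slack_unsaturated; split=> // h flow_h h_cap.
pose reduced a := (w a)%:Z - (p (head a) - p (tail a)).
have reducedE f : is_flow s t f k ->
    \sum_a (f a)%:Z * reduced a = (flow_cost w f)%:Z - k%:Z * (p t - p s).
  move=> flow_f; rewrite -flow_f sum_Posz -sumrB; apply: eq_bigr => a _.
  by rewrite PoszM -mulrBr.
have : 0 <= \sum_a ((h a)%:Z * reduced a - (g a)%:Z * reduced a).
  apply: sumr_ge0 => a _; rewrite -mulrBl /reduced.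
  have := slack_used a; have := slack_unsaturated a; have := h_cap a.
  have [lt_hg|lt_gh|->] := ltngtP (h a) (g a); last by rewrite subrr mul0r.
  - by move=> _ _ /(_ (leq_ltn_trans (leq0n _) lt_hg)) ?; apply: mulr_le0; lia.
  - by move=> le_cap /(_ (leq_trans lt_gh le_cap)) ? _; apply: mulr_ge0; lia.
by rewrite sumrB !reducedE //; lia.
Qed.

End NetworkFlows.

Lemma is_flow_comp (V : finType) (W : eqType) (A : finType) (f : V -> W)
    (tail head : A -> V) s t g k : injective f ->
  is_flow (f \o tail) (f \o head) (f s) (f t) g k <-> is_flow tail head s t g k.
Proof.
move=> f_inj; split=> flow_g p; last exact: (flow_g (p \o f)).
pose q d := if [pick v | f v == d] is Some v then p v else 0%R.
have qE v : q (f v) = p v.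
  by rewrite /q; case: pickP => [u /eqP/f_inj->|/(_ v)] //; rewrite eqxx.
by have := flow_g q; rewrite !qE => <-; apply: eq_bigr => a _; rewrite /= !qE.
Qed.

Lemma min_cost_flow_comp (V : finType) (W : eqType) (A : finType) (f : V -> W)
    (tail head : A -> V) s t w cap k g : injective f ->
  min_cost_flow (f \o tail) (f \o head) (f s) (f t) w cap k g ->
  min_cost_flow tail head s t w cap k g.
Proof.
move=> f_inj [flow_g g_cap g_min]; split=> //; first exact/(is_flow_comp _ _ _ _ _ _ f_inj).
by move=> h /(is_flow_comp _ _ _ _ _ _ f_inj); exact: g_min.
Qed.

(** * The primal-dual flow algorithm *)

(* A residual arc: the name of the arc it is a copy of, its source and target,
   its reduced cost, and whether the copy carries flow (it is then stored
   reversed). *)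
Local Notation residual T := (T * (tree * (tree * (seq bool * bool))))%type.

(* The flow units still to be sent (in unary), the reached vertices, the arcs
   of the search tree (both latest first), and the remaining residual arcs. *)
Local Notation flow_state T :=
  (seq unit * (seq tree * (seq (residual T) * seq (residual T))))%type.

Section FlowAlgorithm.
Context {T : Type}.
Implicit Types (e : residual T) (X : seq tree) (r q : seq (residual T)).
Implicit Types (v s t : tree) (st : flow_state T).

Definition arc_id e : T := e.1.
Definition src e : tree := e.2.1.
Definition dst e : tree := e.2.2.1.
Definition rcost e : seq bool := e.2.2.2.1.
Definition used e : bool := e.2.2.2.2.

Definition pending st : seq unit := st.1.
Definition reached st : seq tree := st.2.1.
Definition tree_arcs st : seq (residual T) := st.2.2.1.
Definition idle_arcs st : seq (residual T) := st.2.2.2.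
Definition state_arcs st : seq (residual T) := tree_arcs st ++ idle_arcs st.

Definition reverse_arc e : residual T :=
  (arc_id e, (dst e, (src e, (rcost e, ~~ used e)))).
Definition set_rcost e c : residual T := (arc_id e, (src e, (dst e, (c, used e)))).
Definition crossing X e : bool := (src e \in X) && (dst e \notin X).

Definition extract_step X (z : option (residual T) * seq (residual T)) e :=
  if crossing X e then
    if z.1 is Some b
    then if blt (rcost e) (rcost b) then (Some e, b :: z.2) else (z.1, e :: z.2)
    else (Some e, z.2)
  else (z.1, e :: z.2).

Definition extract_cheapest X r := foldl (extract_step X) (None, [::]) r.

Definition reprice X (d : seq bool) e : residual T :=
  if crossing X e then set_rcost e (bsub (rcost e) d)
  else if (src e \notin X) && (dst e \in X) then set_rcost e (badd (rcost e) d)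
  else e.

Definition augment_step (z : tree * seq (residual T)) e :=
  if dst e == z.1 then (src e, reverse_arc e :: z.2) else (z.1, e :: z.2).

(* Reverses the path of the search tree [q] that ends in [v], and moves all the
   arcs of [q] to [r]. *)
Definition augment v r q : seq (residual T) := (foldl augment_step (v, r) q).2.

Definition flow_step s t st : flow_state T :=
  if nilp (pending st) then st
  else if t \in reached st then
    (behead (pending st), ([:: s], ([::], augment t (idle_arcs st) (tree_arcs st))))
  else
    let z := extract_cheapest (reached st) (idle_arcs st) in
    if z.1 is Some b
    then (pending st, (dst b :: reached st,
           (set_rcost b [::] :: tree_arcs st, map (reprice (reached st) (rcost b)) z.2)))
    else st.

Definition flow_run s t (k : seq unit) r : flow_state T :=
  iter ((size k).+1 * (size r).+1) (flow_step s t) (k, ([:: s], ([::], r))).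

Lemma augment_cons v r e q :
  augment v r (e :: q) =
  if dst e == v then augment (src e) (reverse_arc e :: r) q else augment v (e :: r) q.
Proof. by rewrite /augment /= {2}/augment_step /=; case: ifP. Qed.

Lemma augment_all (P : pred (residual T)) v r q :
  all P r -> all (fun e => P e && P (reverse_arc e)) q -> all P (augment v r q).
Proof.
elim: q v r => //= e q IH v r Pr /andP[/andP[Pe Pe'] Pq].
by rewrite augment_cons; case: ifP => _; apply: IH => //=; rewrite ?Pe ?Pe'.
Qed.

Lemma augment_count (P : pred (residual T)) v r q :
  (forall e, P (reverse_arc e) = P e) -> count P (augment v r q) = count P q + count P r.
Proof.
move=> P_rev; elim: q v r => //= e q IH v r.
by rewrite augment_cons; case: ifP => _; rewrite IH /= ?P_rev; lia.
Qed.

Lemma size_augment v r q : size (augment v r q) = size q + size r.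
Proof. by rewrite -!count_predT augment_count. Qed.

Lemma reprice_fields X d e :
  [/\ arc_id (reprice X d e) = arc_id e, src (reprice X d e) = src e,
      dst (reprice X d e) = dst e & used (reprice X d e) = used e].
Proof. by rewrite /reprice; case: ifP => _ //; case: ifP. Qed.

End FlowAlgorithm.

Section FlowCorrectness.
Local Open Scope ring_scope.
Context {T : eqType} {A : finType}.
Variables (name : A -> T) (arc_of : T -> A) (tail head : A -> tree) (w cap : A -> nat).
Variables (s t : tree).
Implicit Types (a : A) (p : tree -> int) (X : seq tree) (k : nat).
Implicit Types (e : residual T) (l q r : seq (residual T)) (st : flow_state T).

Definition extract_spec X r (z : option (residual T) * seq (residual T)) : Prop :=
  if z.1 is Some b then
    [/\ perm_eq (b :: z.2) r, crossing X b
      & all (fun e => crossing X e ==> (bval (rcost b) <= bval (rcost e))%N) r]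
  else all (fun e => ~~ crossing X e) r /\ perm_eq z.2 r.

Lemma extract_step_spec X r z e :
  extract_spec X r z -> extract_spec X (e :: r) (extract_step X z e).
Proof.
rewrite /extract_step; case: z => [[b|] z] /=.
- case=> /= perm_r cross_b /allP min_b.
  have perm_er : perm_eq (b :: e :: z) (e :: r).
    rewrite -(perm_cons e) in perm_r; rewrite (perm_trans _ perm_r) //.
    by apply/permEl; exact: (perm_catCA [:: b] [:: e] z).
  case: ifPn => cross_e; last by split=> //=; rewrite (negbTE cross_e); apply/allP.
  rewrite bltE; case: ltnP => cost_eb; last first.
    by split=> //=; rewrite cross_e cost_eb; apply/allP.
  split; [by rewrite /= perm_cons; exact: perm_r | exact: cross_e |].
  rewrite /= leqnn implybT; apply/allP => e' /min_b.
  by case: crossing => //=; apply: leq_trans; exact: ltnW.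
- case=> /= none_cross perm_r; case: ifPn => cross_e /=; last first.
    by split=> /=; rewrite ?cross_e ?perm_cons.
  split=> //=; first by rewrite perm_cons.
  by rewrite leqnn implybT; apply: sub_all none_cross => e' /negbTE->.
Qed.

Lemma extract_cheapestP X r : extract_spec X r (extract_cheapest X r).
Proof.
suff rev_spec q z l : extract_spec X q z ->
    extract_spec X (catrev l q) (foldl (extract_step X) z l).
  have := rev_spec [::] (None, [::]) r (conj isT (perm_refl _)); rewrite -/(rev r).
  rewrite -/(extract_cheapest X r); case: extract_cheapest => [[b|] z].
    case=> perm_r cross_b min_b; split; [|exact: cross_b | by rewrite -all_rev].
    exact: perm_trans perm_r (permEl (perm_rev r)).
  case=> none_cross perm_r; split; first by rewrite -all_rev.
  exact: perm_trans perm_r (permEl (perm_rev r)).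
by elim: l q z => //= e l IH q z spec_z; apply/IH/extract_step_spec.
Qed.

Definition copy_of a e : bool := arc_of (arc_id e) == a.

Definition oriented e : bool :=
  [&& src e == (if used e then head else tail) (arc_of (arc_id e)),
      dst e == (if used e then tail else head) (arc_of (arc_id e))
    & arc_id e == name (arc_of (arc_id e))].

Definition priced p e : bool :=
  (bval (rcost e))%:Z ==
  (if used e then - (w (arc_of (arc_id e)))%:Z else (w (arc_of (arc_id e)))%:Z)
    + p (src e) - p (dst e).

Definition excess p l : int := \sum_(e <- l | used e) (p (src e) - p (dst e)).

Fixpoint search_tree X q {struct q} : bool :=
  if q is e :: q' then
    if X is x :: X' then
      [&& dst e == x, src e \in X', x \notin X' & search_tree X' q']
    else false
  else X == [:: s].

Record flow_inv k st : Prop := FlowInv {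
  inv_count : forall a, count (copy_of a) (state_arcs st) = cap a;
  inv_oriented : all oriented (state_arcs st);
  inv_priced : exists p, all (priced p) (state_arcs st);
  inv_tight : all (fun e => bval (rcost e) == 0%N) (tree_arcs st);
  inv_pending : (size (pending st) <= k)%N;
  inv_excess : forall p,
    excess p (state_arcs st) = (k - size (pending st))%N%:Z * (p t - p s);
  inv_tree : search_tree (reached st) (tree_arcs st) }.

Lemma excess_cat p l l' : excess p (l ++ l') = excess p l + excess p l'.
Proof. exact: big_cat. Qed.

Lemma excess_cons p e l :
  excess p (e :: l) = (if used e then p (src e) - p (dst e) else 0) + excess p l.
Proof. by rewrite /excess big_cons; case: ifP; rewrite ?add0r. Qed.

Lemma excess_perm p l l' : perm_eq l l' -> excess p l = excess p l'.
Proof. by move=> perm_l; apply: perm_big. Qed.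

Lemma excess_reprice p X d l : excess p (map (reprice X d) l) = excess p l.
Proof.
rewrite /excess big_map; apply: eq_big => [e|e _].
  by have [_ _ _ ->] := reprice_fields X d e.
by have [_ -> -> _] := reprice_fields X d e.
Qed.

Lemma excess_reverse p e l :
  excess p (reverse_arc e :: l) = excess p (e :: l) + (p (dst e) - p (src e)).
Proof.
rewrite !excess_cons /reverse_arc /used /src /dst /=.
by case: (e.2.2.2.2) => /=; lia.
Qed.

Lemma excess_augment p X v r q : search_tree X q -> v \in X ->
  excess p (augment v r q) = excess p q + excess p r + (p v - p s).
Proof.
elim: q X v r => [|e q IH] X v r /=.
  by move=> /eqP-> /[!inE] /eqP->; rewrite /augment /excess big_nil /=; lia.
case: X => // x X /and4P[/eqP dst_e src_X _ tree_q]; rewrite in_cons => v_xX.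
rewrite augment_cons dst_e; case: eqP => [<-|/eqP neq_xv].
  by rewrite (IH _ _ _ tree_q src_X) excess_reverse !excess_cons dst_e; lia.
have v_X : v \in X by case/orP: v_xX neq_xv => // /eqP->; rewrite eqxx.
by rewrite (IH _ _ _ tree_q v_X) !excess_cons; lia.
Qed.

Lemma search_tree_root X q : search_tree X q -> s \in X.
Proof.
elim: q X => [|e q IH] X /=; first by move/eqP->; rewrite inE.
by case: X => // x X /and4P[_ _ _ /IH s_X]; rewrite in_cons s_X orbT.
Qed.

Lemma search_tree_inside X q : search_tree X q ->
  {in q, forall e, (src e \in X) && (dst e \in X)}.
Proof.
elim: q X => [|e q IH] X //=; case: X => // x X /and4P[/eqP dst_e src_X _ /IH in_X] e'.
rewrite !(in_cons x) in_cons => /orP[/eqP->|/in_X/andP[-> ->]]; last by rewrite !orbT.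
by rewrite dst_e src_X eqxx orbT.
Qed.

Lemma oriented_reprice X d e : oriented (reprice X d e) = oriented e.
Proof. by rewrite /oriented; have [-> -> -> ->] := reprice_fields X d e. Qed.

Lemma oriented_reverse e : oriented (reverse_arc e) = oriented e.
Proof.
rewrite /oriented /reverse_arc /src /dst /used /arc_id /=.
by case: (e.2.2.2.2) => /=; exact: andbCA.
Qed.

Lemma copy_of_reprice a X d e : copy_of a (reprice X d e) = copy_of a e.
Proof. by rewrite /copy_of; have [-> _ _ _] := reprice_fields X d e. Qed.

Definition raise_outside X (d : nat) p : tree -> int :=
  fun v => p v + (if v \in X then 0 else d%:Z).

Lemma priced_reprice p X d e : crossing X e ==> (bval d <= bval (rcost e))%N ->
  priced p e -> priced (raise_outside X (bval d) p) (reprice X d e).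
Proof.
rewrite /priced /raise_outside; have [-> -> -> ->] := reprice_fields X d e.
rewrite /reprice /crossing; move: (if used e then _ else _) => c.
case: (src e \in X); case: (dst e \in X) => /= le_d /eqP price.
- by rewrite price; lia.
- by rewrite /set_rcost /rcost /= bsubE //; move: price le_d; rewrite /rcost; lia.
- by rewrite /set_rcost /rcost /= baddE //; move: price le_d; rewrite /rcost; lia.
- by rewrite price; lia.
Qed.

Lemma priced_raise_inside p X d e :
  (src e \in X) && (dst e \in X) -> priced (raise_outside X d p) e = priced p e.
Proof. by rewrite /priced /raise_outside => /andP[-> ->]; rewrite !addr0. Qed.

Lemma priced_set_rcost0 p X e : crossing X e -> priced p e ->
  priced (raise_outside X (bval (rcost e)) p) (set_rcost e [::]).
Proof.
rewrite /priced /raise_outside /crossing /set_rcost /rcost /used /src /dst /arc_id /=.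
by move=> /andP[-> /negbTE->] /eqP price; apply/eqP; move: price; lia.
Qed.

Lemma priced_reverse p e : bval (rcost e) == 0%N -> priced p e -> priced p (reverse_arc e).
Proof.
rewrite /priced /reverse_arc /rcost /used /src /dst /arc_id /= => /eqP->.
by case: (e.2.2.2.2) => /= /eqP; lia.
Qed.

Lemma flow_inv_augment k u K X q r :
  flow_inv k (u :: K, (X, (q, r))) -> t \in X ->
  flow_inv k (K, ([:: s], ([::], augment t r q))).
Proof.
case; rewrite /state_arcs /tree_arcs /idle_arcs /pending /reached /=.
move=> count_arcs oriented_arcs [p priced_arcs] tight lt_Kk excess_arcs tree_q t_X.
move: oriented_arcs priced_arcs; rewrite !all_cat.
move=> /andP[oriented_q oriented_r] /andP[priced_q priced_r].
split; rewrite /state_arcs /tree_arcs /idle_arcs /pending /reached //=.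
- by move=> a; rewrite augment_count // -count_cat.
- apply: augment_all => //; apply: sub_all oriented_q => e oriented_e.
  by rewrite oriented_reverse oriented_e.
- exists p; apply: augment_all => //; apply/allP => e e_q.
  by rewrite priced_reverse (allP priced_q, allP tight).
- exact: ltnW.
- move=> p'; rewrite (excess_augment _ _ tree_q t_X) -excess_cat excess_arcs.
  by rewrite [(k - size K)%N](_ : _ = (k - (size K).+1).+1); lia.
Qed.

Lemma flow_inv_grow k K X q r r' b :
  flow_inv k (K, (X, (q, r))) -> extract_spec X r (Some b, r') ->
  flow_inv k (K, (dst b :: X, (set_rcost b [::] :: q, map (reprice X (rcost b)) r'))).
Proof.
case; rewrite /state_arcs /tree_arcs /idle_arcs /pending /reached /=.
move=> count_arcs oriented_arcs [p priced_arcs] tight le_Kk excess_arcs tree_q.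
case=> /= perm_r cross_b; rewrite -(perm_all _ perm_r) => /andP[_ /allP min_b].
move: oriented_arcs priced_arcs; rewrite !all_cat -!(perm_all _ perm_r) /=.
move=> /and3P[oriented_q oriented_b oriented_r] /and3P[priced_q priced_b priced_r].
split; rewrite /state_arcs /tree_arcs /idle_arcs /pending /reached //=.
- move=> a; rewrite -count_arcs !count_cat -(permP perm_r) /= count_map.
  by rewrite (eq_count (copy_of_reprice a X (rcost b))); exact: addnCA.
- rewrite all_cat all_map oriented_q (_ : oriented (set_rcost b _) = oriented b) //.
  by rewrite oriented_b; apply: sub_all oriented_r => e; rewrite /= oriented_reprice.
- exists (raise_outside X (bval (rcost b)) p); rewrite all_cat all_map priced_set_rcost0 //=.
  apply/andP; split; apply/allP => e e_in /=.
    rewrite priced_raise_inside ?(allP priced_q) //.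
    exact: search_tree_inside tree_q _ e_in.
  by apply: priced_reprice; [exact: min_b | exact: (allP priced_r)].
- move=> p'; rewrite -excess_arcs excess_cons !excess_cat excess_reprice.
  rewrite -(excess_perm p' perm_r) excess_cons; exact: addrCA.
- by case/andP: cross_b => -> ->; rewrite eqxx.
Qed.

Lemma flow_step_inv k st : flow_inv k st -> flow_inv k (flow_step s t st).
Proof.
case: st => [[|u K] [X [q r]]] inv_st //; rewrite /flow_step /=.
case: ifP => [t_X|_]; first exact: flow_inv_augment inv_st t_X.
have := extract_cheapestP X r; rewrite /reached /idle_arcs /=.
by case: extract_cheapest => [[b|] r'] //=; exact: flow_inv_grow inv_st.
Qed.

Definition flow_done st : bool :=
  nilp (pending st) ||
  (t \notin reached st) && all (fun e => ~~ crossing (reached st) e) (idle_arcs st).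

Definition flow_measure st : nat :=
  (size (pending st) * (size (state_arcs st)).+1 + size (idle_arcs st))%N.

Lemma flow_step_done st : flow_done st -> flow_step s t st = st.
Proof.
rewrite /flow_step /flow_done; case: nilp => //= /andP[/negbTE-> /allP none_cross].
have := extract_cheapestP (reached st) (idle_arcs st).
case: extract_cheapest => [[b|] r] //= [perm_r cross_b _].
have /none_cross : b \in idle_arcs st by rewrite -(perm_mem perm_r) mem_head.
by rewrite cross_b.
Qed.

Lemma flow_step_measure st :
  ~~ flow_done st -> (flow_measure (flow_step s t st) < flow_measure st)%N.
Proof.
case: st => [[|u K] [X [q r]]]; rewrite /flow_done /flow_step /flow_measure //=.
rewrite /state_arcs /pending /reached /tree_arcs /idle_arcs /=; case: ifP => _ /=.
  by rewrite size_cat size_augment; nia.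
have := extract_cheapestP X r; case: extract_cheapest => [[b|] r'] /=; last by case=> ->.
by case=> /perm_size /= size_r _ _ _; rewrite !size_cat /= !size_map -size_r; nia.
Qed.

Lemma flow_iter_done n st :
  (flow_measure st < n)%N -> flow_done (iter n (flow_step s t) st).
Proof.
elim: n st => // n IH st; rewrite ltnS iterSr => le_n.
have [done_st|/flow_step_measure lt_st] := boolP (flow_done st).
  by rewrite flow_step_done // iter_fix // flow_step_done.
by apply: IH; exact: leq_trans le_n.
Qed.

Definition fresh e : bool :=
  [&& ~~ used e, oriented e & bval (rcost e) == w (arc_of (arc_id e))].

Lemma sum_by_copy l (P : pred (residual T)) (F : A -> int) :
  \sum_(e <- l | P e) F (arc_of (arc_id e)) =
  \sum_a (count (fun e => copy_of a e && P e) l)%:Z * F a.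
Proof.
elim: l => [|e l IH] /=; first by rewrite big_nil big1 // => a _; rewrite mul0r.
under [RHS]eq_bigr do rewrite PoszD mulrDl.
rewrite big_split /= -IH big_cons; case: (P e); last first.
  by rewrite [X in _ = X + _]big1 ?add0r // => a _; rewrite andbF mul0r.
congr (_ + _); rewrite (bigD1 (arc_of (arc_id e))) //= /copy_of eqxx mul1r.
by rewrite big1 ?addr0 // => a; rewrite eq_sym => /negbTE->; rewrite mul0r.
Qed.

Definition used_count st a : nat := count (fun e => copy_of a e && used e) (state_arcs st).

Section Outcome.
Variables (k : nat) (st : flow_state T).
Hypothesis inv_st : flow_inv k st.

Lemma used_count_cap a : (used_count st a <= cap a)%N.
Proof. by rewrite -(inv_count inv_st); apply: sub_count => e /= /andP[]. Qed.

Lemma used_count_flow :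
  is_flow tail head s t (used_count st) (k - size (pending st)).
Proof.
move=> p; rewrite -(inv_excess inv_st) -sum_by_copy /excess.
rewrite big_seq_cond [RHS]big_seq_cond; apply: eq_bigr => e /andP[e_st used_e].
have := allP (inv_oriented inv_st) e e_st; rewrite /oriented used_e.
by case/and3P=> /eqP-> /eqP->.
Qed.

Lemma used_copy a : (0 < used_count st a)%N ->
  exists e, [/\ e \in state_arcs st, used e, arc_of (arc_id e) = a,
                src e = head a & dst e = tail a].
Proof.
rewrite -has_count => /hasP[e e_st /andP[/eqP id_e used_e]]; exists e.
have := allP (inv_oriented inv_st) e e_st; rewrite /oriented used_e id_e.
by case/and3P => /eqP-> /eqP->.
Qed.

Lemma unused_copy a : (used_count st a < cap a)%N ->
  exists e, [/\ e \in state_arcs st, ~~ used e, arc_of (arc_id e) = a,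
                src e = tail a & dst e = head a].
Proof.
rewrite -(inv_count inv_st) => lt_count.
have /hasP[e e_st /andP[/eqP id_e unused_e]] :
    has (fun e => copy_of a e && ~~ used e) (state_arcs st).
  apply: contraLR lt_count => /hasPn no_unused; rewrite -leqNgt.
  apply/eq_leq/esym/eq_in_count => e /no_unused.
  by case: copy_of => //= /negPn->.
exists e; have := allP (inv_oriented inv_st) e e_st.
rewrite /oriented (negbTE unused_e) id_e.
by case/and3P => /eqP-> /eqP->.
Qed.

Lemma used_count_min_cost :
  nilp (pending st) -> min_cost_flow tail head s t w cap k (used_count st).
Proof.
move=> /nilP no_pending; have [p /allP priced_st] := inv_priced inv_st.
apply: (@complementary_slackness _ _ tail head _ _ _ _ _ _ p).
- by have := used_count_flow; rewrite no_pending subn0.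
- exact: used_count_cap.
- move=> a /used_copy[e [/priced_st/eqP + used_e id_e src_e dst_e]].
  by rewrite used_e id_e src_e dst_e; lia.
- move=> a /unused_copy[e [/priced_st/eqP + unused_e id_e src_e dst_e]].
  by rewrite (negbTE unused_e) id_e src_e dst_e; lia.
Qed.

Lemma stuck_small_cut : flow_done st -> ~~ nilp (pending st) ->
  exists X : pred tree, [/\ X s, ~~ X t & (\sum_(a | leaving tail head X a) cap a < k)%N].
Proof.
rewrite /flow_done => /orP[->//|/andP[t_out /allP none_cross]] pending_st.
exists (mem (reached st)); have s_in := search_tree_root (inv_tree inv_st); split=> //.
have boundary e : e \in state_arcs st -> ~~ crossing (reached st) e.
  rewrite mem_cat => /orP[/(search_tree_inside (inv_tree inv_st))|/none_cross//].
  by rewrite /crossing => /andP[_ ->]; rewrite andbF.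
have saturated a : leaving tail head (mem (reached st)) a -> used_count st a = cap a.
  move=> leaving_a; apply/eqP; rewrite eqn_leq used_count_cap leqNgt; apply/negP.
  move=> /unused_copy[e [/boundary + _ _ src_e dst_e]].
  by rewrite /crossing src_e dst_e; move: leaving_a; rewrite /leaving /= => ->.
have empty a : leaving tail head (predC (mem (reached st))) a -> used_count st a = 0%N.
  rewrite /leaving /= negbK => /andP[tail_out head_in]; apply/eqP; rewrite -leqn0 leqNgt.
  apply/negP => /used_copy[e [/boundary + _ _ src_e dst_e]].
  by rewrite /crossing src_e dst_e head_in tail_out.
have := flow_across_cut used_count_flow s_in t_out.
rewrite (eq_bigr cap saturated) (eq_bigr (fun=> 0%N) empty) big1_eq addn0 => ->.
have : (0 < size (pending st))%N by rewrite lt0n.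
by have := inv_pending inv_st; lia.
Qed.

End Outcome.

Section Run.
Variables (K : seq unit) (l : seq (residual T)).
Hypotheses (fresh_l : all fresh l) (count_l : forall a, count (copy_of a) l = cap a).

Lemma flow_run_inv : flow_inv (size K) (flow_run s t K l).
Proof.
rewrite /flow_run; elim: {1}(_ * _)%N => [|n IH]; last first.
  by rewrite iterS; exact: flow_step_inv.
split=> //=; rewrite /state_arcs /=.
- by apply: sub_all fresh_l => e /and3P[].
- exists (fun=> 0); apply: sub_all fresh_l => e /and3P[/negbTE unused_e _ /eqP price].
  by rewrite /priced unused_e price addr0 subr0.
- move=> p; rewrite subnn mul0r /excess big_seq_cond big1 // => e /andP[].
  by move/(allP fresh_l)/and3P => -[/negbTE->].
Qed.

Lemma flow_run_done : flow_done (flow_run s t K l).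
Proof.
apply: flow_iter_done.
rewrite /flow_measure /state_arcs /pending /tree_arcs /idle_arcs /=; nia.
Qed.

Lemma flow_run_min_cost : nilp (pending (flow_run s t K l)) ->
  min_cost_flow tail head s t w cap (size K) (used_count (flow_run s t K l)).
Proof. exact: used_count_min_cost flow_run_inv. Qed.

Lemma flow_run_small_cut : ~~ nilp (pending (flow_run s t K l)) ->
  exists X : pred tree,
    [/\ X s, ~~ X t & (\sum_(a | leaving tail head X a) cap a < size K)%N].
Proof. exact: stuck_small_cut flow_run_inv flow_run_done. Qed.

End Run.

End FlowCorrectness.

(* The algorithm itself, run with zero costs, proves the theorem. *)
Theorem max_flow_min_cut (V A : finType) (tail head : A -> V) (s t : V)
    (cap : A -> nat) (k : nat) :
  (exists2 g, is_flow tail head s t g k & forall a, g a <= cap a) \/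
  (exists X : pred V, [/\ X s, ~~ X t & \sum_(a | leaving tail head X a) cap a < k]).
Proof.
pose name (v : V) := unary (enum_rank v).
have name_inj : injective name by move=> u v /unary_inj/val_inj/enum_rank_inj.
pose copy a : residual A := (a, (name (tail a), (name (head a), ([::], false)))).
pose l := flatten [seq nseq (cap a) (copy a) | a <- enum A].
have fresh_l : all (fresh id id (name \o tail) (name \o head) (fun=> 0)) l.
  apply/allP => e /flattenP[q /mapP[a _ ->] /nseqP[-> _]].
  by rewrite /fresh /oriented /used /src /dst /arc_id /rcost /= !eqxx.
have count_l a : count (copy_of id a) l = cap a.
  rewrite count_flatten -map_comp sumnE big_map big_enum /= (bigD1 a) //= count_nseq.
  rewrite /copy_of /arc_id eqxx mul1n big1 ?addn0 // => b /negbTE neq_ba.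
  by rewrite count_nseq /= neq_ba.
set st := flow_run (name s) (name t) (nseq k tt) l.
case: (boolP (nilp (pending st))) => [done_l|stuck]; [left | right].
  have [] := flow_run_min_cost fresh_l count_l done_l; rewrite size_nseq.
  by move=> /(is_flow_comp _ _ _ _ _ _ name_inj) flow_g g_cap _; exists (used_count id st).
have [X [Xs Xt]] := flow_run_small_cut fresh_l count_l stuck; rewrite size_nseq => small_X.
by exists (X \o name).
Qed.

(** * Running time of the flow algorithm *)

Local Notation tree_residual := (residual tree).
Local Notation tree_state := (flow_state tree).

Definition default_residual : tree_residual := (Leaf, (Leaf, (Leaf, ([::], false)))).

Ltac unfold_arcs :=
  rewrite /reprice /crossing /set_rcost /reverse_arc /arc_id /src /dst /rcost /used.

Section FlowTime.
Context {A : Type} {eA : Enc A}.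

Lemma ptime_extract_cheapest (X : A -> seq tree) (r : A -> seq tree_residual) :
  ptime X -> ptime r -> ptime (fun a => extract_cheapest (X a) (r a)).
Proof.
move=> pX pr; apply: (ptime_comp2 _ pX pr).
apply: (ptime_foldl_additive (step := fun q => extract_step q.1)
  (init := fun=> (None, [::])) (m := esize) (k := 1) (g := fun=> 2)).
- by move=> z; lia.
- move=> q [o l] e; have e_gt0 : 0 < esize e by exact: esize_gt0.
  by rewrite /extract_step /=; case: o => [b|]; do ?case: ifP => _; rewrite !esizeE; lia.
- by solve_pbounded.
- by solve_pbounded.
- rewrite /extract_step; apply: ptime_if; [by unfold_arcs; solve_ptime| |by solve_ptime].
  apply: (ptime_option default_residual
    (f := fun q => q.2.1.1)
    (g := fun q b => if blt (rcost q.2.2) (rcost b) then (Some q.2.2, b :: q.2.1.2)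
       else (q.2.1.1, q.2.2 :: q.2.1.2))
    (h := fun q => (Some q.2.2, q.2.1.2))).
  + by solve_ptime.
  + by unfold_arcs; solve_ptime.
  + by solve_ptime.
- by solve_ptime.
- by solve_ptime.
Qed.

Lemma ptime_augment (v : A -> tree) (r q : A -> seq tree_residual) :
  ptime v -> ptime r -> ptime q -> ptime (fun a => augment (v a) (r a) (q a)).
Proof.
move=> pv pr pq; have p_init : ptime (fun a => (v a, r a)) by solve_ptime.
apply/ptime_snd/(ptime_foldl_additive (step := fun=> augment_step)
  (m := esize) (k := 1) (g := fun=> 5)) => //.
- by move=> z; lia.
- move=> a [x l] [i [y [z [c u]]]].
  rewrite /augment_step /reverse_arc /arc_id /src /dst /rcost /used /=.
  have := esize_bool (~~ u).
  by case: ifP => _; rewrite !esizeE; lia.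
- exact: ptime_esize p_init.
- by solve_pbounded.
- by rewrite /augment_step; unfold_arcs; solve_ptime.
Qed.

End FlowTime.

Lemma ptime_flow_step A (eA : Enc A) (s t : A -> tree) (st : A -> tree_state) :
  ptime s -> ptime t -> ptime st -> ptime (fun a => flow_step (s a) (t a) (st a)).
Proof.
move=> ps pt pst.
apply: (ptime_comp (g := fun q : tree * (tree * tree_state) => flow_step q.1 q.2.1 q.2.2)
  _ (ptime_pair ps (ptime_pair pt pst))).
rewrite /flow_step /pending /reached /idle_arcs /tree_arcs.
apply: ptime_if; [by solve_ptime|by solve_ptime|].
apply: ptime_if; first by solve_ptime.
  by solve_ptime; apply: ptime_augment; solve_ptime.
apply: (ptime_option default_residual
  (f := fun q => (extract_cheapest q.2.2.2.1 q.2.2.2.2.2).1)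
  (g := fun q b => (q.2.2.1, (dst b :: q.2.2.2.1,
     (set_rcost b [::] :: q.2.2.2.2.1, map (reprice q.2.2.2.1 (rcost b))
        (extract_cheapest q.2.2.2.1 q.2.2.2.2.2).2))))
  (h := fun q => q.2.2)).
- by solve_ptime; apply: ptime_extract_cheapest; solve_ptime.
- by unfold_arcs; solve_ptime; apply: ptime_extract_cheapest; solve_ptime.
- by solve_ptime.
Qed.

Definition arc_bounded (b d : nat) (e : tree_residual) : bool :=
  [&& esize (arc_id e) <= b, esize (src e) <= b, esize (dst e) <= b & size (rcost e) <= d].

(* Repricing adds at most one bit to a reduced cost in each of the [i] steps. *)
Definition state_bounded (b i : nat) (st : tree_state) : bool :=
  [&& esize (pending st) <= b, all (fun x => esize x <= b) (reached st),
      size (reached st) <= i.+1, all (arc_bounded b (b + i)) (state_arcs st)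
    & size (state_arcs st) <= b].

Lemma arc_boundedW b d d' e : d <= d' -> arc_bounded b d e -> arc_bounded b d' e.
Proof. by rewrite /arc_bounded => le_d /and4P[-> -> -> le_e] /=; lia. Qed.

Lemma arc_bounded_reverse b d e : arc_bounded b d (reverse_arc e) = arc_bounded b d e.
Proof. by congr (_ && _); exact: andbCA. Qed.

Lemma arc_bounded_reprice b d X c e :
  size c <= d -> arc_bounded b d e -> arc_bounded b d.+1 (reprice X c e).
Proof.
move=> le_c bounded_e; have := bounded_e; rewrite /arc_bounded.
have [-> -> -> _] := reprice_fields X c e => /and4P[-> -> -> le_e] /=.
rewrite /reprice; case: ifP => _; first by rewrite /rcost /= size_bsub leqW.
case: ifP => _; last by rewrite leqW.
by rewrite /rcost /= size_badd ltnS geq_max le_c andbT.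
Qed.

Lemma arc_bounded_esize b d e : arc_bounded b d e -> esize e <= 3 * b + 4 * d + 11.
Proof.
case: e => [i [x [y [c u]]]]; rewrite /arc_bounded /arc_id /src /dst /rcost /=.
case/and4P=> le_i le_x le_y le_c.
by have := esize_bool u; have := esize_bits c; rewrite !esize_pair; lia.
Qed.

Lemma state_bounded_esize b i st :
  state_bounded b i st -> i <= b -> esize st <= 30 * (b.+1 * b.+1) + 30.
Proof.
case: st => [k [X [q r]]].
rewrite /state_bounded /state_arcs /pending /reached /tree_arcs /idle_arcs.
rewrite all_cat size_cat /=.
move=> /and5P[le_k le_X size_X /andP[le_q le_r] size_qr] le_ib.
have arcs_le l : all (arc_bounded b (b + i)) l -> esize l <= (size l * (11 * b + 11).+1).+1.
  by move=> le_l; apply: esize_seq_le; apply: sub_all le_l => e /arc_bounded_esize; lia.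
have := arcs_le _ le_q; have := arcs_le _ le_r; have := esize_seq_le le_X.
by rewrite !esize_pair; clear -le_k size_X size_qr le_ib; nia.
Qed.

Lemma flow_step_bounded b i s t st : esize s <= b ->
  state_bounded b i st -> state_bounded b i.+1 (flow_step s t st).
Proof.
move=> le_s /and5P[le_pending le_reached size_reached arcs size_arcs].
have weaken l : all (arc_bounded b (b + i)) l -> all (arc_bounded b (b + i.+1)) l.
  by apply: sub_all => e; apply: arc_boundedW; lia.
have unchanged : state_bounded b i.+1 st.
  by apply/and5P; split=> //; [exact: leqW | exact: weaken].
rewrite /flow_step; case: ifP => _ //.
move: arcs size_arcs; rewrite /state_arcs all_cat size_cat.
move=> /andP[tree_b idle_b] size_arcs; case: ifP => _.
  apply/and5P; split; rewrite /pending /reached /state_arcs /= ?size_augment ?le_s //.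
  - move: le_pending; rewrite /pending.
    by case: (st.1) => //= x k; rewrite esize_cons; lia.
  - apply/weaken/augment_all => //; apply: sub_all tree_b => e bounded_e.
    by rewrite arc_bounded_reverse bounded_e.
have := extract_cheapestP (reached st) (idle_arcs st).
case: extract_cheapest => [[m|] r] //= [/= perm_r _ _].
move: idle_b; rewrite -(perm_all _ perm_r) => /= /andP[m_b r_b].
have [/and4P[id_m src_m dst_m cost_m] /= size_r] := (m_b, perm_size perm_r).
apply/and5P; split => //.
- by rewrite /reached /= dst_m.
- rewrite /state_arcs /= all_cat weaken //= all_map; apply/andP; split.
    by apply/and4P; split.
  apply: sub_all r_b => e bounded_e /=.
  by rewrite addnS; exact: arc_bounded_reprice.
- by rewrite /state_arcs size_cat /= size_map; lia.
Qed.

Lemma flow_iter_bounded b i n s t st : esize s <= b ->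
  state_bounded b i st -> state_bounded b (i + n) (iter n (flow_step s t) st).
Proof.
move=> le_s; elim: n => [|n IH] bounded_st; first by rewrite addn0.
by rewrite addnS iterS; apply: flow_step_bounded => //; exact: IH.
Qed.

Lemma initial_state_bounded b s (k : seq unit) (r : seq tree_residual) :
  esize s + esize k + esize r <= b -> state_bounded b 0 (k, ([:: s], ([::], r))).
Proof.
move=> le_b; have size_r : size r <= esize r by exact: size_le_esize.
have r_b : all (fun e => esize e <= esize r) r by exact: all_esize_le.
rewrite /state_bounded /pending /reached /state_arcs /idle_arcs /= andbT addn0.
apply/and4P; split=> //; try lia.
apply: sub_all r_b => -[i [x [y [c u]]]]; rewrite !esize_pair => le_e.
have size_c : size c <= esize c by exact: size_le_esize.
by apply/and4P; split; rewrite /arc_id /src /dst /rcost /=; lia.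
Qed.

Definition unary_mul (u v : seq unit) : seq unit := flatten [seq v | _ <- u].

Lemma size_unary_mul u v : size (unary_mul u v) = size u * size v.
Proof. by rewrite /unary_mul; elim: u => //= x u IH; rewrite size_cat IH. Qed.

Lemma ptime_unary_mul A (eA : Enc A) (u v : A -> seq unit) :
  ptime u -> ptime v -> ptime (fun a => unary_mul (u a) (v a)).
Proof.
move=> pu pv; rewrite /unary_mul; solve_ptime.
by apply: ptime_comp pv _; solve_ptime.
Qed.

Lemma ptime_flow_run A (eA : Enc A) (s t : A -> tree) (k : A -> seq unit)
    (r : A -> seq tree_residual) :
  ptime s -> ptime t -> ptime k -> ptime r ->
  ptime (fun a => flow_run (s a) (t a) (k a) (r a)).
Proof.
move=> ps pt pk pr.
pose clock a := unary_mul (tt :: k a) (tt :: [seq tt | _ <- r a]).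
have p_clock : ptime clock by apply: ptime_unary_mul; solve_ptime.
have size_clock a : size (clock a) = (size (k a)).+1 * (size (r a)).+1.
  by rewrite size_unary_mul /= size_map.
pose (b := fun a => esize (s a) + esize (k a) + esize (r a) + esize (clock a)).
have pb_b : pbounded b by rewrite /b; solve_pbounded.
apply: (ptime_ext (f := fun a =>
    iter (size (clock a)) (flow_step (s a) (t a)) (k a, ([:: s a], ([::], r a))))).
  by move=> a; rewrite size_clock.
apply: (ptime_iter (step := fun a st => flow_step (s a) (t a) st)
  (M := fun a => 30 * ((b a).+1 * (b a).+1) + 30)) => //.
- apply: ptime_flow_step; last by solve_ptime.
    by apply: ptime_comp ps _; solve_ptime.
  by apply: ptime_comp pt _; solve_ptime.
- by solve_ptime.
- by solve_pbounded.
move=> a i le_i; have size_b : size (clock a) <= esize (clock a) by exact: size_le_esize.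
apply: (@state_bounded_esize _ (0 + i)); last by rewrite /b; lia.
apply: flow_iter_bounded; first by rewrite /b; lia.
by apply: initial_state_bounded; rewrite /b leq_addr.
Qed.

(** * Disjoint paths and feasible sets *)

Section DisjointPaths.
Variable I : ftf_instance.
Implicit Types (x y : vertex I) (a f : darc I) (S : {set darc I}) (p : seq (darc I)).
Implicit Types (X : pred (vertex I)) (g : darc I -> nat).

Local Notation leaves := (leaving (@arc_tail I) (@arc_head I)).
Local Notation flow := (is_flow (@arc_tail I) (@arc_head I)).

Lemma diwalk_leaves X x p y :
  diwalk x p y -> X x -> ~~ X y -> exists2 a, a \in p & leaves X a.
Proof.
elim: p x => [|a p IH] x /=; first by move=> /eqP-> ->.
case/andP=> /eqP <- walk_p Xx Xy; have [Xa|Xa] := boolP (X (arc_head a)).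
  by have [b b_p Xb] := IH _ walk_p Xa Xy; exists b; rewrite // in_cons b_p orbT.
by exists a; rewrite ?mem_head // /leaving Xx.
Qed.

Lemma disjoint_paths_le_cut X k x y S :
  has_disjoint_paths k x y S -> X x -> ~~ X y -> k <= #|[set a in S | leaves X a]|.
Proof.
move=> [P [path_P disj_P]] Xx Xy.
have /fin_all_exists[c crosses] i : exists a, (a \in P i) && leaves X a.
  have [/andP[walk_i _] _] := path_P i.
  by have [a a_P Xa] := diwalk_leaves walk_i Xx Xy; exists a; rewrite a_P.
have c_inj : injective c.
  move=> i j eq_c; apply/eqP/negPn/negP => neq_ij.
  have /andP[ci_P _] := crosses i; have /andP[cj_P _] := crosses j.
  by have := disj_P i j neq_ij (c i); rewrite ci_P eq_c cj_P.
rewrite -[k in k <= _]card_ord -(card_imset predT c_inj); apply: subset_leq_card.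
apply/subsetP => a /imsetP[i _ ->]; have /andP[ci_P leaves_c] := crosses i.
by rewrite inE leaves_c andbT; have [_ sub_i] := path_P i; exact: sub_i.
Qed.

Lemma has_disjoint_paths_sub k x y S S' :
  S \subset S' -> has_disjoint_paths k x y S -> has_disjoint_paths k x y S'.
Proof.
move=> /subsetP sub_S [P [path_P disj_P]]; exists P; split=> // i.
by have [? sub_i] := path_P i; split=> // a /sub_i/sub_S.
Qed.

Lemma connect_dipath S x y :
  connect [rel u v | [exists a in S, (arc_tail a == u) && (arc_head a == v)]] x y ->
  exists2 p, dipath x p y & {subset p <= S}.
Proof.
case/connectP=> q0 /shortenP[q path_q uniq_q _ ->] {q0}.
suff [p [walk_p heads_p sub_p]] : exists p, [/\ diwalk x p (last x q),
    [seq arc_head a | a <- p] = q & {subset p <= S}].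
  by exists p => //; rewrite /dipath walk_p heads_p.
elim: q x path_q {uniq_q} => [|v q IH] x /=; first by move=> _; exists [::]; split=> /=.
case/andP=> /existsP[a /and3P[a_S /eqP tail_a /eqP head_a]].
move=> /IH[p [walk_p heads_p sub_p]]; exists (a :: p).
split=> /=; rewrite ?tail_a ?eqxx ?head_a ?heads_p //.
by move=> b; rewrite in_cons => /orP[/eqP->|/sub_p].
Qed.

Section UnitFlows.
Local Open Scope ring_scope.

Lemma dipath_flow x p y : dipath x p y -> flow x y (fun a => a \in p) 1.
Proof.
case/andP=> walk_p /=/andP[_ /map_uniq uniq_p] h.
transitivity (\sum_(a <- p) (h (arc_head a) - h (arc_tail a))).
  rewrite [RHS]big_uniq // [RHS]big_mkcond; apply: eq_bigr => a _.
  by case: (a \in p); rewrite ?mul1r ?mul0r.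
rewrite mul1r; elim: p x walk_p {uniq_p} => [|a p IH] x /=.
  by move/eqP->; rewrite big_nil subrr.
by case/andP=> /eqP <- /IH; rewrite big_cons => ->; lia.
Qed.

Lemma flow_connect k x y S : flow x y (fun a => a \in S) k.+1 ->
  exists2 p, dipath x p y & {subset p <= S}.
Proof.
move=> flow_S; apply: connect_dipath; set r := (X in connect X).
apply/negPn/negP => disconnected.
have := flow_le_cut flow_S (X := connect r x) (connect0 _ _) disconnected.
rewrite big1 // => a /andP[conn_tail /negP not_conn_head]; apply/eqP; rewrite eqb0.
apply/negP => a_S; apply: not_conn_head; apply: connect_trans conn_tail (connect1 _).
by apply/existsP; exists a; rewrite a_S !eqxx.
Qed.

Lemma flow_disjoint_paths k x y S :
  flow x y (fun a => a \in S) k -> has_disjoint_paths k x y S.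
Proof.
elim: k S => [|k IH] S flow_S; first by exists (fun=> [::]); split=> [[]|[]].
have [p path_p sub_p] := flow_connect flow_S.
have [|P [path_P disj_P]] := IH (S :\: [set a in p]).
  move=> h; have -> : k%:Z * (h y - h x) = k.+1%:Z * (h y - h x) - 1 * (h y - h x).
    by rewrite -addn1 PoszD mulrDl addrK.
  rewrite -(flow_S h) -(dipath_flow path_p h) -sumrB; apply: eq_bigr => a _; rewrite !inE.
  by have := sub_p a; case: (a \in p) => [->//|_] /=; rewrite ?mul0r ?subrr ?subr0.
exists (fun i => if unlift ord0 i is Some j then P j else p); split.
  move=> i; case: unliftP => [j _|_]; last by [].
  by have [? sub_j] := path_P j; split=> // a /sub_j; rewrite inE => /andP[].
have outside j a : a \in P j -> a \notin p.
  by have [_ sub_j] := path_P j => /sub_j; rewrite !inE => /andP[].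
move=> i j; case: (unliftP ord0 i) => [i' ->|->]; case: (unliftP ord0 j) => [j' ->|->].
- by rewrite (inj_eq lift_inj) => /disj_P.
- by move=> _ a; apply/negP => /andP[/outside/negP].
- by move=> _ a; apply/negP => /andP[a_p /outside/negP].
- by rewrite eqxx.
Qed.

End UnitFlows.

Theorem menger k x y S :
  has_disjoint_paths k x y S <->
  forall X, X x -> ~~ X y -> k <= #|[set a in S | leaves X a]|.
Proof.
split=> [paths X|cuts]; first exact: disjoint_paths_le_cut paths.
have [[g flow_g g_le]|[X [Xx Xy]]] :=
  max_flow_min_cut (@arc_tail I) (@arc_head I) x y (fun a => a \in S) k; last first.
  have -> : \sum_(a | leaves X a) (a \in S) = #|[set a in S | leaves X a]|.
    rewrite -sum1_card big_mkcond [RHS]big_mkcond; apply: eq_bigr => a _.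
    by rewrite inE andbC; case: leaves; case: (a \in S).
  by rewrite ltnNge cuts.
apply: (has_disjoint_paths_sub (S := [set a | 0 < g a])).
  by apply/subsetP => a; rewrite inE; have := g_le a; case: (a \in S); lia.
apply: flow_disjoint_paths => p; rewrite -flow_g; apply: eq_bigr => a _; congr (_%:Z * _)%R.
by rewrite inE; have := g_le a; case: (a \in S); lia.
Qed.

End DisjointPaths.

Lemma robust_card_capacity (T : finType) (M D : {set T}) (f0 : T) (l : nat) : f0 \in M ->
  (forall f, f \in M -> l <= #|D :\ f|) <->
  l * l.+1 <= \sum_(a in D) (if a \in M then l else l.+1).
Proof.
move=> f0_M; split=> [robust|le_capacity f f_M].
  have [f /andP[f_D f_M]|no_M] := pickP (fun f => (f \in D) && (f \in M)).
    rewrite mulnC; apply: (@leq_trans (#|D| * l)).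
      by rewrite leq_mul2r (cardsD1 f D) f_D ltnS robust ?orbT.
    by rewrite -sum_nat_const; apply: leq_sum => a _; case: ifP.
  apply: (@leq_trans (#|D| * l.+1)).
    by rewrite leq_mul2r (leq_trans (robust _ f0_M)) ?orbT // subset_leq_card ?subD1set.
  rewrite -sum_nat_const; apply: leq_sum => a a_D.
  by have := no_M a; rewrite a_D /= => ->.
have : \sum_(a in D) (if a \in M then l else l.+1) <= l + #|D :\ f| * l.+1.
  have rest_le : \sum_(a in D :\ f) (if a \in M then l else l.+1) <= #|D :\ f| * l.+1.
    by rewrite -sum_nat_const; apply: leq_sum => a _; case: ifP.
  case: (boolP (f \in D)) => [f_D|f_D]; first by rewrite (big_setD1 f) //= f_M leq_add2l.
  have D1 : D :\ f = D by apply/setDidPl; rewrite disjoint_sym disjoints1.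
  by rewrite D1 in rest_le *; apply: leq_trans rest_le (leq_addl _ _).
by move: le_capacity; nia.
Qed.

Section Feasibility.
Variable I : ftf_instance.
Implicit Types (a f : darc I) (S : {set darc I}) (X : pred (vertex I)).
Implicit Types (g w : darc I -> nat).

Local Notation leaves := (leaving (@arc_tail I) (@arc_head I)).
Local Notation st_flow := (is_flow (@arc_tail I) (@arc_head I) (source I) (target I)).

Definition capacity a : nat := if a \in vulnerable I then ell I else (ell I).+1.

Lemma feasible_cut_capacity f0 S : f0 \in vulnerable I ->
  feasible S <-> forall X, X (source I) -> ~~ X (target I) ->
    ell I * (ell I).+1 <= \sum_(a in S | leaves X a) capacity a.
Proof.
move=> f0_M; have cutE X : \sum_(a in S | leaves X a) capacity a =
    \sum_(a in [set a in S | leaves X a]) capacity a.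
  by apply: eq_bigl => a; rewrite inE.
have cutD1 X f : [set a in S :\ f | leaves X a] = [set a in S | leaves X a] :\ f.
  by apply/setP => a; rewrite !inE andbA.
split=> [feas_S X Xs Xt|cuts f f_M].
  rewrite cutE; apply/(robust_card_capacity _ _ f0_M) => f f_M; rewrite -cutD1.
  by have /menger := feas_S f f_M; apply.
apply/menger => X Xs Xt; rewrite cutD1.
by have := cuts X Xs Xt; rewrite cutE => /(robust_card_capacity _ _ f0_M); apply.
Qed.

Lemma support_feasible g :
  st_flow g (ell I * (ell I).+1) -> (forall a, g a <= capacity a) ->
  feasible [set a | 0 < g a].
Proof.
move=> flow_g g_le f f_M; apply: (feasible_cut_capacity _ f_M).2 (f) f_M => X Xs Xt.
apply: leq_trans (flow_le_cut flow_g Xs Xt) _.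
rewrite big_mkcond [leqRHS]big_mkcond; apply: leq_sum => a _; rewrite inE andbC.
by case: leaves => //=; case: posnP => // ->.
Qed.

Lemma feasible_flow f0 S : f0 \in vulnerable I -> feasible S ->
  exists2 g, st_flow g (ell I * (ell I).+1) & forall a, g a <= (a \in S) * capacity a.
Proof.
move=> f0_M /(feasible_cut_capacity _ f0_M) cuts.
have [//|[X [Xs Xt]]] := max_flow_min_cut (@arc_tail I) (@arc_head I) (source I) (target I)
  (fun a => (a \in S) * capacity a) (ell I * (ell I).+1).
rewrite ltnNge => /negP[]; apply: leq_trans (cuts X Xs Xt) _.
rewrite big_mkcond [leqRHS]big_mkcond; apply: leq_sum => a _.
by case: (a \in S); case: leaves; rewrite /= ?mul1n.
Qed.

Lemma min_cost_support_le w g f0 S :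
  min_cost_flow (@arc_tail I) (@arc_head I) (source I) (target I) w capacity
    (ell I * (ell I).+1) g ->
  f0 \in vulnerable I -> feasible S ->
  \sum_(a in [set a | 0 < g a]) w a <= (ell I).+1 * \sum_(a in S) w a.
Proof.
move=> [_ _ g_min] f0_M feas_S; have [h flow_h h_le] := feasible_flow f0_M feas_S.
have h_cap a : h a <= capacity a.
  by apply: leq_trans (h_le a) _; case: (_ \in _); rewrite ?mul1n.
apply: leq_trans (leq_trans _ (g_min h flow_h h_cap)) _.
  rewrite big_mkcond; apply: leq_sum => a _; rewrite inE.
  by case: posnP => // g_gt0; rewrite leq_pmull.
rewrite big_distrr [leqRHS]big_mkcond; apply: leq_sum => a _ /=.
have := h_le a; case: (a \in S); last by rewrite mul0n leqn0 => /eqP->.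
rewrite mul1n leq_mul2r => le_h; apply/orP; right; apply: leq_trans le_h _.
by rewrite /capacity; case: ifP.
Qed.

End Feasibility.

(** * The approximation algorithm *)

Local Notation raw_arc := (tree * (tree * ((seq bool * seq bool) * (bool * unit))))%type.
Local Notation raw_instance :=
  (tree * (seq raw_arc * (tree * (tree * (seq bool * unit)))))%type.

Definition raw_tail (a : raw_arc) : tree := a.1.
Definition raw_head (a : raw_arc) : tree := a.2.1.
Definition raw_num (a : raw_arc) : seq bool := a.2.2.1.1.
Definition raw_den (a : raw_arc) : seq bool := a.2.2.1.2.
Definition raw_vulnerable (a : raw_arc) : bool := a.2.2.2.1.

Definition raw_arcs (x : raw_instance) : seq raw_arc := x.2.1.
Definition raw_source (x : raw_instance) : tree := x.2.2.1.
Definition raw_target (x : raw_instance) : tree := x.2.2.2.1.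
Definition raw_ell (x : raw_instance) : seq bool := x.2.2.2.2.1.

Definition enumerate_step E (z : tree * seq (tree * E)) (e : E) :=
  (Node Leaf z.1, (z.1, e) :: z.2).

Definition enumerate E (l : seq E) : seq (tree * E) :=
  rev (foldl (@enumerate_step E) (Leaf, [::]) l).2.

(* Multiplying each weight by the denominators of all the others makes them
   integral. *)
Definition scaled_weight (l : seq (tree * raw_arc)) (a : tree * raw_arc) : seq bool :=
  foldl (fun acc b => if b.1 == a.1 then acc else bmul (raw_den b.2) acc) (raw_num a.2) l.

Definition unused_copy_of l (a : tree * raw_arc) : tree_residual :=
  (a.1, (raw_tail a.2, (raw_head a.2, (scaled_weight l a, false)))).

Definition copies (u : seq unit) (l : seq (tree * raw_arc)) : seq tree_residual :=
  flatten [seq [seq unused_copy_of l a | _ <- if raw_vulnerable a.2 then u else tt :: u]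
          | a <- l].

Definition decrement_step (z : seq bool * seq unit) : seq bool * seq unit :=
  if has id z.1 then (bsub z.1 [:: true], tt :: z.2) else z.

(* The value of [b] can be exponential in its length, hence the cut-off at [n];
   there is no feasible solution when [ell] exceeds the number of arcs. *)
Definition to_unary (b : seq bool) (n : nat) : seq bool * seq unit :=
  iter n decrement_step (b, [::]).

Definition ftf_flow (s t : tree) (u : seq unit) (l : seq (tree * raw_arc)) :
    option (seq bool) :=
  let st := flow_run s t (unary_mul u (tt :: u)) (copies u l) in
  if nilp (pending st)
  then Some [seq has (fun e => (arc_id e == a.1) && used e) (state_arcs st) | a <- l]
  else None.

Definition ftf_alg (x : raw_instance) : option (seq bool) :=
  if (raw_source x == raw_target x) || ~~ has raw_vulnerable (raw_arcs x)
  then Some [seq false | _ <- raw_arcs x]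
  else
    let z := to_unary (raw_ell x) (size (raw_arcs x)) in
    if has id z.1 then None
    else ftf_flow (raw_source x) (raw_target x) z.2 (enumerate (raw_arcs x)).

Lemma enumerate_foldl E (l : seq E) n acc :
  foldl (@enumerate_step E) (unary n, acc) l =
  (unary (n + size l), catrev (zip (map unary (iota n (size l))) l) acc).
Proof.
elim: l n acc => [|e l IH] n acc /=; first by rewrite addn0.
by rewrite /enumerate_step -[Node _ _]/(unary n.+1) IH addnS.
Qed.

Lemma enumerateE E (l : seq E) : enumerate l = zip (map unary (iota 0 (size l))) l.
Proof. by rewrite /enumerate (enumerate_foldl l 0) -/(rev _) revK. Qed.

Lemma bval_to_unary b n : bval (to_unary b n).1 = bval b - n.
Proof.
elim: n => [|n IH]; rewrite ?subn0 // /to_unary iterS /decrement_step -/(to_unary b n).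
have := bval_eq0 (to_unary b n).1; case: ifP => pos /= E; last by lia.
by rewrite bsubE /=; lia.
Qed.

Lemma size_to_unary b n : size (to_unary b n).2 = minn (bval b) n.
Proof.
elim: n => [|n IH]; rewrite ?minn0 // /to_unary iterS /decrement_step -/(to_unary b n).
have := bval_eq0 (to_unary b n).1; have := bval_to_unary b n.
by case: ifP => pos /=; lia.
Qed.

(** * Running time of the approximation algorithm *)

Ltac unfold_input :=
  rewrite /raw_source /raw_target /raw_ell /raw_arcs
    /raw_tail /raw_head /raw_num /raw_den /raw_vulnerable.

Lemma esize_zip_unary E (eE : Enc E) (l : seq E) n b :
  all (fun e => esize e <= b) l -> n + size l <= b ->
  all (fun p : tree * E => esize p <= 4 * b) (zip (map unary (iota n (size l))) l).
Proof.
elim: l n => //= e l IH n /andP[le_e le_l] le_b; rewrite IH ?andbT //; last by lia.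
by rewrite esize_pair /= esize_unary; lia.
Qed.

Lemma ptime_enumerate A E (eA : Enc A) (eE : Enc E) (l : A -> seq E) :
  ptime l -> ptime (fun a => enumerate (l a)).
Proof.
move=> pl; apply/ptime_rev/ptime_snd.
apply: (ptime_foldl (step := fun _ => @enumerate_step E) (init := fun=> (Leaf, [::]))
  (M := fun a => 20 * (esize (l a) * esize (l a)) + 20)) => //.
- by rewrite /enumerate_step; solve_ptime.
- by solve_ptime.
- by solve_pbounded.
move=> a i; rewrite (enumerate_foldl _ 0) add0n esize_pair -/(rev _) esize_rev esize_unary.
set m := size _; have le_m : m <= esize (l a).
  exact: size_take_le_esize.
set z := zip _ _; have size_z : size z = m by rewrite size_zip size_map size_iota minnn.
have z_le : all (fun p : tree * E => esize p <= 4 * esize (l a)) z.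
  by apply: esize_zip_unary => //; exact: all_esize_take.
apply: leq_ltn_trans (leq_add (leqnn _) (esize_seq_le z_le)) _.
by rewrite size_z; clear -le_m; nia.
Qed.

Lemma ptime_scaled_weight A (eA : Enc A) (l : A -> seq (tree * raw_arc))
    (b : A -> tree * raw_arc) :
  ptime l -> ptime b -> ptime (fun a => scaled_weight (l a) (b a)).
Proof.
move=> pl pb; apply: (ptime_comp2 _ pl pb); rewrite /scaled_weight; unfold_input.
apply: (ptime_foldl_additive (m := size) (k := 4) (g := fun=> 2)
  (step := fun q acc b => if b.1 == q.2.1 then acc else bmul b.2.2.2.1.2 acc)
  (init := fun q => q.2.2.2.2.1.1)).
- exact: esize_bits.
- move=> q acc [i [x [y [[num den] z]]]]; case: ifP => _ /=; first by lia.
  apply: leq_trans (size_bmul _ _) _; rewrite leq_add2l leq_mul2l /=.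
  by apply: leq_trans (size_le_esize _) _; rewrite !esize_pair; lia.
- apply: (pbounded_le (h := fun q => esize (q.2.2.2.2.1.1))); last first.
    by apply: ptime_esize; solve_ptime.
  by move=> q; exact: size_le_esize.
- by solve_pbounded.
- by solve_ptime.
- by solve_ptime.
- by solve_ptime.
Qed.

Lemma ptime_copies A (eA : Enc A) (u : A -> seq unit) (l : A -> seq (tree * raw_arc)) :
  ptime u -> ptime l -> ptime (fun a => copies (u a) (l a)).
Proof.
move=> pu pl; apply: (ptime_comp2 (F := copies) _ pu pl).
rewrite /copies /unused_copy_of; unfold_input; solve_ptime.
by apply: ptime_scaled_weight; solve_ptime.
Qed.

Lemma ptime_to_unary A E (eA : Enc A) (eE : Enc E) (b : A -> seq bool) (l : A -> seq E) :
  ptime b -> ptime l -> ptime (fun a => to_unary (b a) (size (l a))).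
Proof.
move=> pb pl; apply: (ptime_iter (step := fun=> decrement_step)
  (init := fun a => (b a, [::]))
  (M := fun a => 10 * (esize (b a) + esize (l a)) + 10)) => //.
- by rewrite /decrement_step; solve_ptime.
- by solve_ptime.
- by solve_pbounded.
move=> a i le_i; rewrite -/(to_unary (b a) i).
have size_rest : size (to_unary (b a) i).1 = size (b a).
  elim: i {le_i} => // i; rewrite /to_unary iterS -/(to_unary (b a) i) /decrement_step.
  by case: ifP => // _; rewrite size_bsub.
have size_l : size (l a) <= esize (l a) by exact: size_le_esize.
have size_b : size (b a) <= esize (b a) by exact: size_le_esize.
have := size_to_unary (b a) i; have := esize_bits (to_unary (b a) i).1; rewrite size_rest.
case: (to_unary (b a) i) => rest count /= le_rest size_count.
have unit_le1 : all (fun e => esize e <= 1) count by apply/allP.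
by have := esize_seq_le unit_le1; rewrite esize_pair; lia.
Qed.

Lemma ptime_ftf_flow A (eA : Enc A) (s t : A -> tree) (u : A -> seq unit)
    (l : A -> seq (tree * raw_arc)) :
  ptime s -> ptime t -> ptime u -> ptime l ->
  ptime (fun a => ftf_flow (s a) (t a) (u a) (l a)).
Proof.
move=> ps pt pu pl.
have p_run : ptime (fun a =>
    flow_run (s a) (t a) (unary_mul (u a) (tt :: u a)) (copies (u a) (l a))).
  apply: ptime_flow_run => //; last exact: ptime_copies.
  by apply: ptime_unary_mul; solve_ptime.
pose output (q : tree_state * seq (tree * raw_arc)) := if nilp (pending q.1)
  then Some [seq has (fun e => (arc_id e == a.1) && used e) (state_arcs q.1)
            | a : tree * raw_arc <- q.2]
  else None.
apply: (ptime_comp (g := output) _ (ptime_pair p_run pl)).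
rewrite /output /state_arcs /tree_arcs /idle_arcs /pending /arc_id /used.
by apply: ptime_if; solve_ptime.
Qed.

Lemma ptime_ftf_alg : ptime ftf_alg.
Proof.
rewrite /ftf_alg; unfold_input; apply: ptime_if; [by solve_ptime|by solve_ptime|].
have p_unary : ptime (fun x : raw_instance => to_unary x.2.2.2.2.1 (size x.2.1)).
  by apply: ptime_to_unary; solve_ptime.
apply: ptime_if; [by solve_ptime|by solve_ptime|].
by apply: ptime_ftf_flow; solve_ptime; apply: ptime_enumerate; solve_ptime.
Qed.

(** * Correctness of the approximation algorithm *)

Fixpoint pos_bits (p : BinNums.positive) : seq bool :=
  match p with
  | BinNums.xH => [:: true]
  | BinNums.xO q => false :: pos_bits q
  | BinNums.xI q => true :: pos_bits q
  end.

Definition nat_bits (n : nat) : seq bool :=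
  if bin_of_nat n is BinNums.Npos p then pos_bits p else [::].

Lemma nat_bitsK : cancel nat_bits bval.
Proof.
move=> n; rewrite -[RHS]bin_of_natK /nat_bits; case: bin_of_nat => //= p.
by elim: p => //= p ->; rewrite NatTrec.doubleE.
Qed.

Lemma enc_nat_bits n : enc (nat_bits n) = enc_nat n.
Proof.
rewrite /nat_bits /enc_nat; case: bin_of_nat => //= p.
by elim: p => //= p <-.
Qed.

Lemma enc_nat_inj : injective enc_nat.
Proof.
pose fix value d := if d is Node x r then is_node x + (value r).*2 else 0.
have valueE b : value (enc b) = bval b by elim: b => //= x b <-; case: x.
by apply: (can_inj (g := value)) => n; rewrite -enc_nat_bits valueE nat_bitsK.
Qed.

Section Instance.
Variable I : ftf_instance.
Notation A := (darc I).
Implicit Types (a b : A) (S : {set A}).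

Definition raw_of_arc a : raw_arc :=
  (enc_nat (arc_tail a), (enc_nat (arc_head a),
    ((nat_bits `|numq (weight a)|, nat_bits `|denq (weight a)|),
     (a \in vulnerable I, tt)))).

Definition raw_of_instance : raw_instance :=
  (enc_seq [seq enc_nat x | x : vertex I <- enum 'I_(nvert I)],
   ([seq raw_of_arc a | a <- enum A],
    (enc_nat (source I), (enc_nat (target I), (nat_bits (ell I), tt))))).

Lemma enc_raw_of_instance : enc raw_of_instance = enc_instance I.
Proof.
have arcsE : [seq enc r | r <- [seq raw_of_arc a | a <- enum A]] =
             [seq enc_arc a | a <- enum A].
  rewrite -map_comp; apply: eq_map => a /=.
  by rewrite /enc_arc /enc_rat -(enc_nat_bits `|numq _|) -(enc_nat_bits `|denq _|).
by rewrite /enc_instance -arcsE -(enc_nat_bits (ell I)).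
Qed.

Definition arc_name a : tree := unary a.

Lemma arc_name_inj : injective arc_name.
Proof. by move=> a b /unary_inj/val_inj. Qed.

(* [a0] is the junk value on trees that name no arc. *)
Definition named_arc a0 (d : tree) : A := odflt a0 [pick a | arc_name a == d].

Lemma arc_nameK a0 : cancel arc_name (named_arc a0).
Proof.
move=> a; rewrite /named_arc; case: pickP => [b /eqP/arc_name_inj//|/(_ a)].
by rewrite eqxx.
Qed.

Definition named_arcs : seq (tree * raw_arc) :=
  [seq (arc_name a, raw_of_arc a) | a <- enum A].

Lemma enumerate_raw_arcs : enumerate [seq raw_of_arc a | a <- enum A] = named_arcs.
Proof.
rewrite enumerateE size_map size_enum_ord -val_enum_ord -map_comp /named_arcs.
by elim: (enum _) => //= a l ->.
Qed.

Lemma size_named_arcs : size named_arcs = narc I.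
Proof. by rewrite size_map size_enum_ord. Qed.

Definition den a : nat := `|denq (weight a)|.

Definition int_weight a : nat := `|numq (weight a)| * \prod_(b | b != a) den b.

Lemma bval_scaled_weight a :
  bval (scaled_weight named_arcs (arc_name a, raw_of_arc a)) = int_weight a.
Proof.
have -> : int_weight a =
    bval (nat_bits `|numq (weight a)|) * \prod_(b <- enum A | b != a) den b.
  by rewrite nat_bitsK big_enum_cond; congr (_ * _); apply: eq_bigl => b.
rewrite /scaled_weight /named_arcs /raw_num /raw_den /=.
elim: (enum _) (nat_bits _) => [|b l IH] acc /=; first by rewrite big_nil muln1.
rewrite IH big_cons (inj_eq arc_name_inj); case: eqP => // _.
by rewrite bmulE nat_bitsK -mulnA mulnCA.
Qed.

Section RationalWeights.
Local Open Scope ring_scope.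

Lemma int_weightE a : (int_weight a)%:R = weight a * (\prod_b den b)%N%:R :> rat.
Proof.
have denE b : (den b)%:R = (denq (weight b))%:~R :> rat by rewrite pmulrn /den absz_denq.
have numE : (`|numq (weight a)|%N)%:R = (numq (weight a))%:~R :> rat.
  by rewrite pmulrn gez0_abs // numq_ge0 weight_ge0.
rewrite [(\prod_b den b)%N](bigD1 a) //= /int_weight !natrM numE denE mulrA.
by rewrite -{2}(divq_num_den (weight a)) divfK // intr_eq0 denq_neq0.
Qed.

Lemma prod_den_gt0 : 0 < (\prod_b den b)%N%:R :> rat.
Proof. by rewrite ltr0n prodn_gt0 // => b; rewrite absz_gt0 denq_neq0. Qed.

Lemma total_weight_scaled S :
  total_weight S * (\prod_b den b)%N%:R = (\sum_(a in S) int_weight a)%N%:R.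
Proof.
by rewrite /total_weight mulr_suml natr_sum; apply: eq_bigr => a _; rewrite int_weightE.
Qed.

Lemma total_weight_ge0 S : 0 <= total_weight S.
Proof. by apply: sumr_ge0 => a _; exact: weight_ge0. Qed.

End RationalWeights.

Definition vertex_name (x : vertex I) : tree := enc_nat x.

Lemma vertex_name_inj : injective vertex_name.
Proof. by move=> x y /enc_nat_inj/val_inj. Qed.

Local Notation tail_name := (vertex_name \o @arc_tail I).
Local Notation head_name := (vertex_name \o @arc_head I).
Local Notation source_name := (vertex_name (source I)).
Local Notation target_name := (vertex_name (target I)).

Lemma copies_fresh (u : seq unit) a0 :
  all (fresh arc_name (named_arc a0) tail_name head_name int_weight) (copies u named_arcs).
Proof.
apply/allP => e /flattenP[q /mapP[_ /mapP[a _ ->] ->] /mapP[_ _ ->]].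
rewrite /fresh /oriented /used /src /dst /arc_id /rcost /= arc_nameK !eqxx /=.
by rewrite bval_scaled_weight.
Qed.

Lemma copies_count (u : seq unit) a0 a : size u = ell I ->
  count (copy_of (named_arc a0) a) (copies u named_arcs) = capacity a.
Proof.
move=> size_u; rewrite /copies count_flatten -map_comp sumnE big_map /named_arcs big_map.
rewrite big_enum /= (bigD1 a) //= count_map (@eq_count _ _ predT); last first.
  by move=> x; rewrite /= /copy_of /arc_id /= arc_nameK eqxx.
rewrite count_predT big1 ?addn0 => [|b neq_ba].
  by rewrite /capacity /raw_vulnerable /=; case: ifP; rewrite /= size_u.
rewrite count_map (@eq_count _ _ pred0) ?count_pred0 // => x.
by rewrite /= /copy_of /arc_id /= arc_nameK (negbTE neq_ba).
Qed.

Lemma used_names_nth a0 k st a :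
  flow_inv arc_name (named_arc a0) tail_name head_name int_weight (@capacity I)
    source_name target_name k st ->
  nth false
    [seq has (fun e => (arc_id e == c.1) && used e) (state_arcs st) | c <- named_arcs] a
  = (0 < used_count (named_arc a0) st a).
Proof.
move=> inv_st; rewrite (nth_map (arc_name a, raw_of_arc a)) ?size_named_arcs //.
rewrite /named_arcs (nth_map a) ?size_enum_ord // nth_ord_enum -has_count.
apply: eq_in_has => e e_st; rewrite /copy_of /=.
have /and3P[_ _ /eqP id_e] := allP (inv_oriented inv_st) e e_st.
by rewrite {1}id_e (inj_eq arc_name_inj).
Qed.

Lemma ftf_flowP (u : seq unit) (f0 : A) : size u = ell I -> f0 \in vulnerable I ->
  match ftf_flow source_name target_name u named_arcs with
  | Some bs => exists2 g, min_cost_flow (@arc_tail I) (@arc_head I) (source I) (target I)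
        int_weight (@capacity I) (ell I * (ell I).+1) g
      & forall a, nth false bs a = (0 < g a)
  | None => forall S, ~ feasible S
  end.
Proof.
move=> size_u f0_M; rewrite /ftf_flow; set K := unary_mul _ _.
have size_K : size K = ell I * (ell I).+1 by rewrite size_unary_mul /= size_u.
have fresh_copies := copies_fresh u f0; have count_copies a := copies_count f0 a size_u.
have inv_run := flow_run_inv source_name target_name K fresh_copies count_copies.
set st := flow_run _ _ _ _ in inv_run *.
case: ifPn => [finished|stuck].
  exists (used_count (named_arc f0) st); last by move=> a; exact: used_names_nth inv_run.
  rewrite -size_K; apply: (min_cost_flow_comp vertex_name_inj).
  exact: flow_run_min_cost fresh_copies count_copies finished.
move=> S feas_S; have [g flow_g g_le] := feasible_flow f0_M feas_S.
have [X [Xs Xt]] := flow_run_small_cut fresh_copies count_copies stuck.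
rewrite size_K ltnNge => /negP[].
apply: leq_trans (flow_le_cut flow_g (X := X \o vertex_name) Xs Xt) _.
apply: leq_sum => a _; apply: leq_trans (g_le a) _.
by case: (_ \in _); rewrite ?mul1n.
Qed.

Lemma size_ftf_alg bs : ftf_alg raw_of_instance = Some bs -> size bs = narc I.
Proof.
rewrite /ftf_alg /raw_arcs; case: ifP => _.
  by case=> <-; rewrite size_map /= size_map size_enum_ord.
case: ifP => // _; rewrite /ftf_flow; case: ifP => // _ [<-].
by rewrite size_map enumerate_raw_arcs size_named_arcs.
Qed.

Definition ftf_solve : option {set A} :=
  omap (fun bs => [set a : A | nth false bs a]) (ftf_alg raw_of_instance).

Lemma enc_ftf_solve : enc (ftf_alg raw_of_instance) = enc_solution ftf_solve.
Proof.
rewrite /ftf_solve; case alg_bs: ftf_alg => [bs|] //=; congr (Node _ _).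
rewrite /enc /enc_list; congr enc_seq.
rewrite -{1}(mkseq_nth false bs) (size_ftf_alg alg_bs) /mkseq -val_enum_ord -!map_comp.
by apply: eq_map => a /=; rewrite inE.
Qed.

Lemma feasible_set0 :
  (source I == target I) || (vulnerable I == set0) -> feasible (set0 : {set A}).
Proof.
case/orP=> [/eqP st|/eqP no_vulnerable] f; last by rewrite no_vulnerable inE.
move=> _; exists (fun=> [::]); split=> // i; split=> //.
by rewrite /dipath /= st eqxx.
Qed.

Lemma feasible_ell_le f0 S :
  source I != target I -> f0 \in vulnerable I -> feasible S -> ell I <= narc I.
Proof.
move=> neq_st f0_M /(_ f0 f0_M)/menger/(_ (pred1 (source I)) (eqxx _)).
rewrite /= eq_sym => /(_ neq_st) le_cut.
by apply: leq_trans le_cut (leq_trans (max_card _) _); rewrite card_ord.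
Qed.

Lemma min_cost_support_weight g f0 S : f0 \in vulnerable I -> feasible S ->
  min_cost_flow (@arc_tail I) (@arc_head I) (source I) (target I) int_weight (@capacity I)
    (ell I * (ell I).+1) g ->
  (total_weight [set a | (0 < g a)%N] <= ((ell I)%:R + 1) * total_weight S)%R.
Proof.
move=> f0_M feas_S min_g; rewrite -(ler_pM2r prod_den_gt0) -mulrA !total_weight_scaled.
by rewrite natr1 -natrM ler_nat; exact: min_cost_support_le min_g f0_M feas_S.
Qed.

Lemma has_raw_vulnerable :
  has raw_vulnerable [seq raw_of_arc a | a <- enum A] = (vulnerable I != set0).
Proof.
rewrite has_map; apply/hasP/set0Pn => [[a _ a_M]|[a a_M]]; first by exists a.
by exists a; rewrite ?mem_enum.
Qed.

Lemma ftf_solveP :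
  match ftf_solve with
  | Some B => feasible B /\ forall S, feasible S ->
      (total_weight B <= ((ell I)%:R + 1) * total_weight S)%R
  | None => forall S, ~ feasible S
  end.
Proof.
rewrite /ftf_solve /ftf_alg /raw_arcs /raw_source /raw_target /raw_ell /=.
rewrite has_raw_vulnerable negbK (inj_eq enc_nat_inj); case: ifPn => [trivial_case|] /=.
  rewrite (_ : finset _ = set0); last first.
    by apply/setP => a; rewrite !inE -map_comp (nth_map a) ?size_enum_ord.
  split=> [|S _]; first exact: feasible_set0.
  by rewrite /total_weight big_set0 mulr_ge0 ?addr_ge0 ?ler0n ?total_weight_ge0.
rewrite negb_or => /andP[neq_st /set0Pn[f0 f0_M]]; set z := to_unary _ _.
have bval_z : bval z.1 = ell I - narc I.
  by rewrite bval_to_unary nat_bitsK size_map size_enum_ord.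
have size_z : size z.2 = minn (ell I) (narc I).
  by rewrite size_to_unary nat_bitsK size_map size_enum_ord.
have := bval_eq0 z.1; rewrite bval_z subn_eq0.
case: ifP => _ /= ell_narc.
  by move=> S /(feasible_ell_le neq_st f0_M); rewrite ell_narc.
rewrite (minn_idPl ell_narc) in size_z; rewrite enumerate_raw_arcs.
have := ftf_flowP size_z f0_M; case: ftf_flow => [bs|] //= [g min_g bsE].
rewrite (_ : finset _ = [set a | 0 < g a]); last by apply/setP => a; rewrite !inE bsE.
have [flow_g g_cap _] := min_g; split=> [|S feas_S]; first exact: support_feasible.
exact: min_cost_support_weight f0_M feas_S min_g.
Qed.

End Instance.

Local Open Scope ring_scope.

Theorem theorem17 :
  exists alg : forall I : ftf_instance, option {set darc I},
    polytime enc_instance enc_solution alg /\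
    approximates (fun I => (ell I)%:R + 1) alg.
Proof.
exists ftf_solve; split; last exact: ftf_solveP.
exact: ptime_polytime ptime_ftf_alg enc_raw_of_instance enc_ftf_solve.
Qed.
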